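(* The dynamical system $\big(B(0,1),\mathcal{B},\mu,T\big)$ is an exact dynamical system.
   Context: Let $p$ be a prime and let $K$ be a finite extension of $\mathbb{Q}_p$ of degree $m$, with ramification index $e$ and residue degree $f$ (so $m=ef$). Let $|\cdot|$ be the unique extension to $K$ of the $p$-adic absolute value with $|p|=p^{-1}$. Let $L\subseteq K$ be the unramified subextension of degree $f$ over $\mathbb{Q}_p$, write $L=\mathbb{Q}_p(\gamma)$ with $\gamma$ a primitive $(p^f-1)$-th root of unity, and fix $\beta\in K$ with $K=L(\beta)$ and $|\beta|=p^{1/e}$. For $b=\sum_{j\ge n_0}a_jp^j\in\mathbb{Q}_p$ with $a_j\in\{0,1,\dots,p-1\}$ put $\lfloor b\rfloor_p=\sum_{n_0\le j\le 0}a_jp^j$ (which is $0$ if $|b|<1$). Every $\alpha\in K$ is uniquely $\alpha=\sum_{i=0}^{e-1}\sum_{j=0}^{f-1}b_{i,j}\gamma^j\beta^i$ with $b_{i,j}\in\mathbb{Q}_p$, and $\lfloor\alpha\rfloor=\sum_{i=0}^{e-1}\sum_{j=0}^{f-1}\lfloor b_{i,j}\rfloor_p\gamma^j\beta^i$. Let $B(0,1)=\{x\in K:|x|<1\}$, let $\mathcal{B}$ be its Borel $\sigma$-algebra, and let $\mu$ be the restriction to $B(0,1)$ of the Haar measure of the additive group $K$, normalized by $\mu(B(0,1))=1$. The continued fraction map $T:B(0,1)\to B(0,1)$ is $T(\alpha)=\frac1\alpha-\left\lfloor\frac1\alpha\right\rfloor$ for $\alpha\ne 0$ and $T(0)=0$.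 A measure-preserving dynamical system $(X,\mathcal{C},\nu,S)$ on a probability space is exact if $\bigcap_{n=0}^{\infty}S^{-n}\mathcal{C}=\mathcal{N}\pmod\nu$, where $\mathcal{N}$ is the trivial sub-$\sigma$-algebra of $\mathcal{C}$ generated by the sets of measure $0$ or $1$; equivalently, every set in $\bigcap_{n\ge 0}S^{-n}\mathcal{C}$ has $\nu$-measure $0$ or $1$. *)

(* Defs.v *)
From HB Require Import structures.
From mathcomp Require Import all_boot all_order all_algebra all_field.
From mathcomp Require Import all_classical all_reals all_analysis.

Set Implicit Arguments.
Unset Strict Implicit.
Unset Printing Implicit Defensive.

Import Order.TTheory GRing.Theory Num.Theory.

Local Open Scope classical_set_scope.
Local Open Scope ring_scope.

Record absval (R : realType) (K : fieldType) := AbsVal {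
  absv :> K -> R;
  absv_ge0 : forall x, 0 <= absv x;
  absv_eq0 : forall x, (absv x == 0) = (x == 0);
  absvM : forall x y, absv (x * y) = absv x * absv y;
  absvD : forall x y, absv (x + y) <= absv x + absv y
}.

Section absval_metric.
Variables (R : realType) (K : fieldType) (v : absval R K).

(* The metric depends on [v], so it is carried by an alias of [K]. *)
Definition vspace of absval R K : Type := K.

Let dist (x y : K) : R := v (x - y).

Let v0 : v 0 = 0. Proof. by apply/eqP; rewrite absv_eq0. Qed.

Let vN x : v (- x) = v x.
Proof.
have v1 : v 1 = 1.
  have v1_neq0 : v 1 != 0 by rewrite absv_eq0 oner_eq0.
  by apply: (mulfI v1_neq0); rewrite -absvM !mulr1.
have vN1 : v (-1) = 1.
  have /eqP : v (-1) ^+ 2 = 1 by rewrite expr2 -absvM mulrNN mulr1 v1.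
  rewrite sqrf_eq1 => /orP[/eqP//|/eqP vN1].
  by have := absv_ge0 v (-1); rewrite vN1 lerNr oppr0 ler10.
by rewrite -mulN1r absvM vN1 mul1r.
Qed.

Let distxx x : dist x x = 0. Proof. by rewrite /dist subrr v0. Qed.

Let dist_pos x y : dist x y = 0 -> x = y.
Proof. by move/eqP; rewrite absv_eq0 subr_eq0 => /eqP. Qed.

Let dist_sym x y : dist x y = dist y x.
Proof. by rewrite /dist -vN opprB. Qed.

Let dist_triangle y x z : dist x z <= dist x y + dist y z.
Proof. by rewrite /dist -(subrKA y x (- z)) absvD. Qed.

HB.instance Definition _ := Choice.copy (vspace v) K.
HB.instance Definition _ := isPointed.Build (vspace v) (0 : K).
HB.instance Definition _ := isMetric.Build R (vspace v)
  distxx dist_pos dist_sym dist_triangle.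

End absval_metric.

Notation borel T := (g_sigma_algebraType (@open T)).

Section unit_ball.
Variables (R : realType) (K : fieldType) (v : absval R K).

Definition unit_ball : set (vspace v) := [set x : K | v x < 1].

Definition unit_ball_type : Type := set_type unit_ball.

Lemma mem0_unit_ball : (0 : K) \in unit_ball.
Proof.
rewrite inE /unit_ball /=.
by have /eqP -> : v 0 == 0; rewrite ?absv_eq0 ?ltr01.
Qed.

HB.instance Definition _ := Topological.copy unit_ball_type (set_type unit_ball).
HB.instance Definition _ := SubType.copy unit_ball_type (set_type unit_ball).
HB.instance Definition _ := isPointed.Build unit_ball_type
  (exist _ (0 : K) mem0_unit_ball).

Lemma open_unit_ball : open unit_ball.
Proof.
rewrite openE => x vx1.
rewrite /interior -nbhs_ballE; exists (1 - v x); first by rewrite /= subr_gt0.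
move=> y /ball_sym; rewrite ballEmdist /= /mdist /= => xy.
rewrite /unit_ball /= -[y](subrK (x : K)).
by rewrite (le_lt_trans (absvD _ _ _)) // -ltrBrDr.
Qed.

Lemma measurable_unit_ball :
  measurable (unit_ball : set (borel (vspace v))).
Proof. by apply: sub_sigma_algebra; exact: open_unit_ball. Qed.

Lemma measurable_image_unit_ball (A : set (borel unit_ball_type)) :
  measurable A -> measurable (\val @` A : set (borel (vspace v))).
Proof.
pose img (A : set (borel unit_ball_type)) : set (borel (vspace v)) := \val @` A.
have inj : injective (\val : unit_ball_type -> vspace v) by exact: val_inj.
pose G : set (set unit_ball_type) := [set A | measurable (img A)].
suff : <<s @open unit_ball_type >> `<=` G by apply.
apply: smallest_sub; first split.
- by rewrite /G /= /img image_set0.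
- move=> B GB; rewrite /G /=.
  have -> : img (setT `\` B) = unit_ball `\` img B.
    apply/seteqP; split=> [_ [x [_ Bx] <-]|x [x1 Bx]].
      split; first by have := valP x; rewrite inE.
      by move=> [y By /inj xy]; apply: Bx; rewrite -xy.
    move/mem_set : x1 => x1; exists (exist _ x x1) => //; split => // Bx'.
    by apply: Bx; exists (exist _ x x1).
  by apply: measurableD => //; exact: measurable_unit_ball.
- move=> F GF; rewrite /G /= /img image_bigcup.
  by apply: bigcup_measurable => i _; exact: GF.
- move=> U [W oW <-]; rewrite /G /=.
  have -> : img (set_val @^-1` W) = unit_ball `&` W.
    apply/seteqP; split=> [_ [x Wx <-]|x [x1 Wx]].
      by split=> //; have := valP x; rewrite inE.
    by move/mem_set : x1 => x1; exists (exist _ x x1).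
  apply: measurableI; first exact: measurable_unit_ball.
  exact: sub_sigma_algebra.
Qed.

Variable mu : {measure set (borel (vspace v)) -> \bar R}.

Definition unit_ball_measure (A : set (borel unit_ball_type)) : \bar R :=
  mu (\val @` A).

Let unit_ball_measure0 : unit_ball_measure set0 = 0%E.
Proof. by rewrite /unit_ball_measure image_set0 measure0. Qed.

Let unit_ball_measure_ge0 A : (0 <= unit_ball_measure A)%E.
Proof. exact: measure_ge0. Qed.

Let unit_ball_measure_sigma_additive : semi_sigma_additive unit_ball_measure.
Proof.
move=> F mF tF mUF; rewrite /unit_ball_measure image_bigcup.
apply: measure_semi_sigma_additive.
- by move=> i; exact: measurable_image_unit_ball.
- apply/trivIsetP => i j _ _ ij.
  move/trivIsetP : tF => /(_ i j I I ij) Fij.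
  rewrite -subset0 => _ [[x Fx <-] [y Fy /val_inj xy]].
  have : (F i `&` F j) x by split => //; rewrite -xy.
  by rewrite Fij.
- by rewrite -image_bigcup; exact: measurable_image_unit_ball.
Qed.

HB.instance Definition _ := isMeasure.Build _ (borel unit_ball_type) R
  unit_ball_measure unit_ball_measure0 unit_ball_measure_ge0
  unit_ball_measure_sigma_additive.

(* A nonzero translation-invariant Radon measure on the additive group. *)
Definition haar_measure :=
  [/\ (exists A, measurable A /\ mu A != 0%E),
      (forall (a : K) (A : set K), measurable (A : set (borel (vspace v))) ->
         mu [set a + x | x in A] = mu A),
      (forall C : set (vspace v), compact C -> (mu C < +oo)%E),
      (forall A : set (vspace v), measurable (A : set (borel (vspace v))) ->
         mu A = ereal_inf [set mu U | U in [set U | open U /\ A `<=` U]]) &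
      (forall U : set (vspace v), open U ->
         mu U = ereal_sup [set mu C | C in [set C | compact C /\ C `<=` U]])].

End unit_ball.

Arguments unit_ball {R K} v.

(* The sign of the exponent is that of [|p| = p^-1]; [numq] and [denq] are
   coprime, so at most one of the two [logn] is nonzero. *)
Definition padic_norm (R : realType) (p : nat) (q : rat) : R :=
  if q == 0 then 0
  else p%:R ^ ((logn p `|denq q|)%:Z - (logn p `|numq q|)%:Z).

(* [Q_p] is specified as the completion of [rat] for the [p]-adic norm. *)
Definition is_padic_field (R : realType) (p : nat) (F : fieldType)
    (v : absval R F) :=
  [/\ (forall q : rat, v (ratr q) = padic_norm R p q),
      dense (range ratr : set (vspace v)) &
      (forall G : set_system (vspace v), ProperFilter G -> cauchy G -> cvg G)].

Section extension.
Variables (R : realType) (F : fieldType) (vF : absval R F).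
Variables (K : fieldExtType F) (vK : absval R K).

(* The index of the value group of [F] in that of [E] is [e]: the [x i] are
   representatives of the [e] cosets. *)
Definition ramification_index (E : {subfield K}) (e : nat) :=
  exists x : 'I_e -> K,
    (forall i, x i \in E /\ x i != 0) /\
    (forall y, y \in E -> y != 0 ->
       exists! i, exists2 c : F, c != 0 & vK y = vK (x i) * vF c).

(* The residue classes of the [x i] form a basis of the residue field of [E]
   over the residue field of [F]. *)
Definition residue_degree (E : {subfield K}) (f : nat) :=
  exists x : 'I_f -> K,
    [/\ (forall i, x i \in E /\ vK (x i) <= 1),
        (forall y, y \in E -> vK y <= 1 ->
           exists2 c : 'I_f -> F, (forall i, vF (c i) <= 1) &
             vK (y - \sum_i c i *: x i) < 1) &
        (forall c : 'I_f -> F, (forall i, vF (c i) <= 1) ->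
           vK (\sum_i c i *: x i) < 1 -> forall i, vF (c i) < 1)].

Definition unramified (E : {subfield K}) := ramification_index E 1.

End extension.

Section continued_fraction_map.
Variables (R : realType) (p : nat) (F : fieldType) (vF : absval R F).

(* [b] is the sum of the [a k * p ^ (n0 + k)], the digit of index [n0 + k]
   being [a k]. *)
Definition padic_expansion (b : F) (n0 : int) (a : nat -> 'I_p) :=
  ((fun n => \sum_(k < n) (a k)%:R * p%:R ^ (n0 + k%:Z)) : nat -> vspace vF)
    @ \oo --> (b : vspace vF).

Definition padic_floor (b : F) : F :=
  xget 0 [set c : F | exists n0 a, padic_expansion b n0 a /\
    c = \sum_(k < `|n0|.+1 | n0 + k%:Z <= 0) (a k)%:R * p%:R ^ (n0 + k%:Z)].

Variables (K : fieldExtType F) (vK : absval R K).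
Variables (e f : nat) (gamma beta : K).

Definition lincomb (b : 'I_e -> 'I_f -> F) : K :=
  \sum_(i < e) \sum_(j < f) b i j *: (gamma ^+ j * beta ^+ i).

Definition ext_floor (alpha : K) : K :=
  xget 0 [set c : K | exists2 b : 'I_e -> 'I_f -> F, alpha = lincomb b &
    c = lincomb (fun i j => padic_floor (b i j))].

(* The value lies in the unit ball whenever [ext_floor] is given by the
   expansion along a basis [gamma ^+ j * beta ^+ i] with [vK beta = p^(1/e)];
   the default value of [insubd] is then irrelevant. *)
Definition cf_map (alpha : unit_ball_type vK) : unit_ball_type vK :=
  let zero : unit_ball_type vK := point in
  let x : K := \val alpha in
  if x == 0 then zero else insubd zero (x^-1 - ext_floor x^-1 : K).

End continued_fraction_map.

Arguments cf_map {R} p {F} vF {K} vK e f gamma beta.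

Definition exact_system d (X : measurableType d) (R : realType)
    (nu : {measure set X -> \bar R}) (S : X -> X) :=
  [/\ nu [set: X] = 1%E,
      measurable_fun [set: X] S,
      (forall A, measurable A -> nu (S @^-1` A) = nu A) &
      (forall A, (\bigcap_n preimage_set_system [set: X] (iter n S) measurable) A
         -> nu A = 0%E \/ nu A = 1%E)].

(* Main.v *)
Require Import Defs.
From HB Require Import structures.
From mathcomp Require Import all_boot all_order all_algebra all_field.
From mathcomp Require Import all_classical all_reals all_analysis.
From mathcomp Require Import ring lra zify.

(* Write b for beta, so that |b| = p^(1/e) generates the value group of K. The
   elements gamma^j b^i form an orthogonal Qp-basis of K: the residues of
   1, .., gamma^(f-1) form a basis of the residue field, and the |b^i|
   represent the cosets of the value group of Qp. Hence every coset of the open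
   unit ball B in K contains exactly one value of the floor function, and T maps
   each set {x : floor (1/x) = d}, which is the ball of centre 1/d and radius
   1/|d|^2, bijectively onto B, multiplying distances by |d|^2. As the measure
   of a ball depends only on its radius, multiplicatively, T is a full-branch
   map with independent branches: mu (D /\ T^-1 E) = mu D * mu E. By iteration,
   T^-n E is independent of all cylinders of rank n. Cylinders shrink, so every
   open set is, up to a null set, an increasing union of countable disjoint
   unions of cylinders; a tail event is therefore independent of every Borel
   set, in particular of itself. *)

Set Implicit Arguments.
Unset Strict Implicit.
Unset Printing Implicit Defensive.

Import Order.TTheory GRing.Theory Num.Theory.

Local Open Scope classical_set_scope.
Local Open Scope ring_scope.

(** * Absolute values *)

(** The mass of a disc comes from counting: a disc splits into [q] translates of the next smaller
    radius, [q] being the size of the residue field, so every mass is a power of [1/q]. Discs are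
    nested or disjoint, hence form a pi-system, and inversion carries discs to discs away from 0;
    independence of a branch is therefore a comparison of two finite measures on discs. Two
    obstacles shape the rest. The floors are defined by a choice among expansions, so orthogonality
    of the basis is needed even to compute them. And a point whose expansion terminates has no
    digits from some rank on, so cylinders are formed among the points whose orbit avoids 0, a set
    of full measure. Instead of indexing cylinders by words of digits, the recursion pulls the
    target open set back along one inverse branch at a time, and independence climbs one rank with
    each branch. *)

Section AbsoluteValue.
Variables (R : realType) (K : fieldType) (v : absval R K).
Implicit Types x y : K.

Lemma absv0 : v 0 = 0.
Proof. by apply/eqP; rewrite absv_eq0. Qed.

Lemma absv_gt0 x : (0 < v x) = (x != 0).
Proof. by rewrite lt_def absv_ge0 andbT absv_eq0. Qed.

Lemma absv1 : v 1 = 1.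
Proof.
have v1 : v 1 != 0 by rewrite absv_eq0 oner_eq0.
by apply: (mulfI v1); rewrite -absvM !mulr1.
Qed.

Lemma absvX x n : v (x ^+ n) = v x ^+ n.
Proof. by elim: n => [|n IH]; rewrite ?expr0 ?absv1// !exprS absvM IH. Qed.

Lemma absv_root1 x n : (0 < n)%N -> x ^+ n = 1 -> v x = 1.
Proof.
move=> n0 xn1; have : v x ^+ n = 1 by rewrite -absvX xn1 absv1.
by move/eqP; rewrite pexpr_eq1 ?absv_ge0// => /eqP.
Qed.

Lemma absvN x : v (- x) = v x.
Proof.
by rewrite -mulN1r absvM (@absv_root1 (-1) 2) ?mul1r// expr2 mulrNN mulr1.
Qed.

Lemma absvB x y : v (x - y) = v (y - x).
Proof. by rewrite -absvN opprB. Qed.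

Lemma absvV x : v x^-1 = (v x)^-1.
Proof.
have [->|x0] := eqVneq x 0; first by rewrite invr0 absv0 invr0.
have vx0 : v x != 0 by rewrite absv_eq0.
by apply: (mulfI vx0); rewrite -absvM !divff ?absv1.
Qed.

Lemma absvXz x (n : int) : v (x ^ n) = v x ^ n.
Proof. by case: n => n; rewrite ?NegzE ?exprnN -?exprnP ?absvV absvX. Qed.

Lemma absv_sum (I : Type) (r : seq I) (F : I -> K) :
  v (\sum_(i <- r) F i) <= \sum_(i <- r) v (F i).
Proof.
elim/big_ind2 : _ => [|x1 x2 y1 y2 h1 h2|//]; first by rewrite absv0.
by rewrite (le_trans (absvD _ _ _))// lerD.
Qed.

Definition ultrametric := forall x y, v (x + y) <= Num.max (v x) (v y).

(* Expanding [(x + y) ^+ n] gives [v (x + y) ^+ n <= n.+1 * max ^+ n], and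
   exponential growth beats linear growth. *)
Lemma ultrametric_nat : (forall n, v n%:R <= 1) -> ultrametric.
Proof.
move=> vn1 x y; set M := Num.max _ _.
have M0 : 0 <= M by rewrite le_max absv_ge0.
have bnd n : v (x + y) ^+ n <= n.+1%:R * M ^+ n.
  rewrite -absvX exprDn (le_trans (absv_sum _ _))//.
  apply: (@le_trans _ _ (\sum_(i < n.+1) M ^+ n)); last first.
    by rewrite sumr_const card_ord mulr_natl.
  apply: ler_sum => i _; rewrite -mulr_natr !absvM !absvX.
  rewrite -[leRHS]mulr1 ler_pM ?mulr_ge0 ?exprn_ge0 ?absv_ge0//.
  have -> : M ^+ n = M ^+ (n - i) * M ^+ i by rewrite -exprD subnK// -ltnS.
  rewrite ler_pM ?exprn_ge0 ?absv_ge0//.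
    by apply: lerXn2r; rewrite ?nnegrE ?absv_ge0// le_max lexx.
  by apply: lerXn2r; rewrite ?nnegrE ?absv_ge0// le_max lexx orbT.
rewrite leNgt; apply/negP => Mlt.
have [M_eq0|M_neq0] := eqVneq M 0.
  by have := bnd 1%N; rewrite M_eq0 !expr1 mulr0 leNgt (le_lt_trans M0 Mlt).
have M_gt0 : 0 < M by rewrite lt_def M_neq0.
pose t := v (x + y) / M - 1.
have t0 : 0 < t by rewrite subr_gt0 ltr_pdivlMr// mul1r.
have rbnd n : (1 + t) ^+ n <= n.+1%:R.
  by rewrite /t addrC subrK expr_div_n ler_pdivrMr ?exprn_gt0.
have bern n : 1 + n%:R * t <= (1 + t) ^+ n.
  elim: n => [|n IH]; first by rewrite mul0r addr0.
  have t1 : 0 <= 1 + t by lra.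
  rewrite exprS; apply: le_trans (ler_wpM2l t1 IH).
  have n0 : 0 <= n%:R :> R by rewrite ler0n.
  by rewrite -natr1 -subr_ge0 (_ : _ - _ = n%:R * t ^+ 2) ?mulr_ge0 ?exprn_ge0
       ?(ltW t0)//; ring.
(* Take [k > 2 / t^2]. Bernoulli's bound at [k] is only linear, but its square gives [(1 + t)^(2k)
   >= 1 + 2kt + k^2 t^2 > 1 + 2k], against [rbnd] at [2k]. *)
have := @archi_boundP R (2 / t ^+ 2); rewrite divr_ge0 ?exprn_ge0 ?(ltW t0)// => /(_ isT).
rewrite ltr_pdivrMr ?exprn_gt0//; set k := Num.bound _ => hk.
have := rbnd (2 * k)%N; rewrite mulnC exprM.
have := bern k.
rewrite -natr1 natrM.
set z := (1 + t) ^+ k; set w := k%:R in hk *; move=> wz zw.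
have t2 : 0 < t ^+ 2 by rewrite exprn_gt0.
have w0 : 0 < w by rewrite -(pmulr_lgt0 _ t2); lra.
have wt : 0 < w * t by rewrite mulr_gt0.
have w2 : w * 2 < w * (w * t ^+ 2) by rewrite ltr_pM2l.
have z2 : (1 + w * t) ^+ 2 <= z ^+ 2.
  by rewrite lerXn2r ?nnegrE//; lra.
have e2 : (1 + w * t) ^+ 2 = 1 + 2 * (w * t) + w * (w * t ^+ 2) by ring.
by move: zw z2; rewrite e2; lra.
Qed.

Hypothesis vU : ultrametric.

Lemma absvD_lt x y r : v x < r -> v y < r -> v (x + y) < r.
Proof. by move=> xr yr; rewrite (le_lt_trans (vU _ _))// gt_max xr. Qed.

Lemma absvD_le x y r : v x <= r -> v y <= r -> v (x + y) <= r.
Proof. by move=> xr yr; rewrite (le_trans (vU _ _))// ge_max xr. Qed.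

Lemma absvB_lt x y r : v x < r -> v y < r -> v (x - y) < r.
Proof. by move=> ? ?; rewrite absvD_lt ?absvN. Qed.

Lemma absvB_le x y r : v x <= r -> v y <= r -> v (x - y) <= r.
Proof. by move=> ? ?; rewrite absvD_le ?absvN. Qed.

Lemma absv_distl_lt x y z r : v (x - y) < r -> v (y - z) < r -> v (x - z) < r.
Proof. by move=> xy yz; rewrite -(subrKA y) absvD_lt. Qed.

Lemma absv_sum_lt (I : Type) (s : seq I) (P : pred I) (F : I -> K) r :
  0 < r -> (forall i, P i -> v (F i) < r) -> v (\sum_(i <- s | P i) F i) < r.
Proof.
move=> r0 Fr; elim/big_ind: _ => //; first by rewrite absv0.
by move=> *; exact: absvD_lt.
Qed.

Lemma absv_sum_le (I : Type) (s : seq I) (P : pred I) (F : I -> K) r :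
  0 <= r -> (forall i, P i -> v (F i) <= r) -> v (\sum_(i <- s | P i) F i) <= r.
Proof.
move=> r0 Fr; elim/big_ind: _ => //; first by rewrite absv0.
by move=> *; exact: absvD_le.
Qed.

(** Were [v x < v y], then [y = x - (x - y)] would be smaller than itself. *)
Lemma absv_near x y : v (x - y) < v y -> v x = v y.
Proof.
move=> xy; apply/eqP; rewrite eq_le; apply/andP; split.
  by rewrite -[x](subrK y) absvD_le// ltW.
rewrite leNgt; apply/negP => xy'.
have := absvB_lt xy' xy; rewrite opprB addrC subrK ltxx //.
Qed.

Lemma absv_int (n : int) : v n%:~R <= 1.
Proof.
have vn (k : nat) : v k%:R <= 1.
  by elim: k => [|k IH]; rewrite ?absv0// -natr1 absvD_le ?absv1.
by case: n => n; rewrite ?NegzE ?rmorphN ?absvN; exact: vn.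
Qed.

End AbsoluteValue.

(** * The metric topology of a valued field *)

Section Topology.
Variables (R : realType) (K : fieldType) (v : absval R K).

Lemma vspace_ballE (x y : vspace v) (r : R) :
  ball x r y = (v ((x : K) - y) < r) :> Prop.
Proof. by rewrite ballEmdist. Qed.

Lemma open_vspaceP (A : set (vspace v)) :
  open A <-> forall x, A x ->
    exists2 r : R, 0 < r & forall y : K, v ((x : K) - y) < r -> A y.
Proof.
rewrite openE; split=> [oA x Ax|oA x /oA[r r0 xrA]].
  have := oA x Ax; rewrite /interior -nbhs_ballE => -[r r0 xrA].
  by exists r.
rewrite /interior -nbhs_ballE; by exists r.
Qed.

Lemma vspace_cvgP (u : nat -> vspace v) (l : vspace v) :
  u @ \oo --> l <->
  forall r : R, 0 < r -> exists N, forall n, (N <= n)%N -> v ((l : K) - u n) < r.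
Proof.
rewrite cvg_ballP; split=> ul r r0.
  by have [N _ uN] := ul r r0; exists N => n; rewrite -vspace_ballE; exact: uN.
by have [N uN] := ul r r0; exists N => // n /= /uN; rewrite -vspace_ballE.
Qed.

End Topology.

(** * The field of p-adic numbers *)

Section PadicField.
Variables (R : realType) (p : nat) (F : fieldType) (v : absval R F).
Hypothesis p_prime : prime p.
Hypothesis F_padic : is_padic_field p v.

Let pR0 : 0 < p%:R :> R. Proof. by rewrite ltr0n prime_gt0. Qed.
Let pR1 : 1 < p%:R :> R. Proof. by rewrite ltr1n prime_gt1. Qed.

Lemma padic_absv_rat (q : rat) : v (ratr q) = padic_norm R p q.
Proof. by case: F_padic. Qed.

Lemma padic_absv_nat (n : nat) :
  (0 < n)%N -> v n%:R = p%:R ^- logn p n.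
Proof.
move=> n0; have := padic_absv_rat n%:~R; rewrite ratr_int => ->.
rewrite /padic_norm intr_eq0 eqz_nat eqn0Ngt n0 /= numq_int denq_int.
by rewrite logn1 sub0r absz_nat exprnN.
Qed.

Lemma padic_absv_natr_le1 (n : nat) : v n%:R <= 1.
Proof.
case: n => [|n]; first by rewrite absv0.
by rewrite padic_absv_nat// invf_le1 ?exprn_gt0// exprn_ege1// ltW.
Qed.

Lemma padic_ultrametric : ultrametric v.
Proof. exact/ultrametric_nat/padic_absv_natr_le1. Qed.

Lemma padic_absv_p : v p%:R = p%:R^-1.
Proof. by rewrite padic_absv_nat ?prime_gt0// logn_prime// eqxx. Qed.

Lemma padic_p_neq0 : p%:R != 0 :> F.
Proof. by rewrite -(absv_gt0 v) padic_absv_p invr_gt0. Qed.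

Lemma padic_absv_nat_lt1 (n : nat) : (v n%:R < 1) = (p %| n)%N.
Proof.
case: n => [|n]; first by rewrite absv0 ltr01 dvdn0.
rewrite padic_absv_nat// invf_lt1 ?exprn_gt0//.
rewrite (_ : (p %| n.+1)%N = (0 < logn p n.+1)%N); last first.
  by rewrite logn_gt0 mem_primes p_prime.
by case: logn => [|k]; rewrite ?expr0 ?ltxx// exprn_egt1.
Qed.

Lemma padic_absv_int_lt1 (n : int) : (v n%:~R < 1) = (p %| n)%Z.
Proof.
case: n => n; first exact: padic_absv_nat_lt1.
by rewrite NegzE rmorphN absvN dvdzE; exact: padic_absv_nat_lt1.
Qed.

Lemma padic_rat_approx (x : F) (r : R) :
  0 < r -> exists q : rat, v (x - ratr q) < r.
Proof.
move=> r0; case: F_padic => _ dns _.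
have [||y [/= xy [q _ qy]]] := dns [set y : vspace v | v (x - y) < r].
- by exists x; rewrite /= subrr absv0.
- apply/open_vspaceP => y /= xy; exists r => // z yz.
  exact: (absv_distl_lt padic_ultrametric xy).
by exists q; rewrite qy.
Qed.

(** By the ultrametric inequality [x] has the same value as any rational close enough to it, so
    completion creates no new values. *)
Lemma padic_absv_value (x : F) : x != 0 -> exists z : int, v x = p%:R ^ z.
Proof.
move=> x0; have vx0 : 0 < v x by rewrite absv_gt0.
have [q xq] := padic_rat_approx x vx0.
have vq : v (ratr q) = v x.
  by apply: absv_near; [exact: padic_ultrametric|rewrite absvB].
move: vq; rewrite padic_absv_rat /padic_norm; case: ifP => [_ e|_ <-].
  by rewrite -e ltxx in vx0.
by eexists.
Qed.

(** Discreteness of the value group. The gap lets a coefficient below 1 absorb any factor smaller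
    than [p]. *)
Lemma padic_absv_lt1 (x : F) : (v x < 1) = (v x <= p%:R^-1).
Proof.
apply/idP/idP => [|h]; last by rewrite (le_lt_trans h)// invf_lt1.
have [->|/padic_absv_value[z ->]] := eqVneq x 0.
  by rewrite absv0 invr_ge0 ler0n.
have -> : p%:R^-1 = p%:R ^ (-1) :> R by [].
by rewrite -(expr0z p%:R) ltr_eXz2l// ler_eXz2l//; lia.
Qed.

(** A rational close to [x] is integral, so its denominator is prime to [p]; Bezout inverts the
    denominator modulo [p], and the digit is the numerator times this inverse, reduced modulo
    [p]. *)
Lemma padic_digit (x : F) : v x <= 1 -> exists d : 'I_p, v (x - d%:R) < 1.
Proof.
move=> x1; have vU := padic_ultrametric.
have [q xq] := padic_rat_approx x ltr01.
have q1 : v (ratr q) <= 1.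
  by rewrite -[ratr q](subKr x) absvB_le// ltW.
have pden : ~~ (p %| `|denq q|)%N.
  apply/negP => pd; move: q1; rewrite padic_absv_rat /padic_norm.
  case: ifPn => [/eqP q0|q0].
    by move: pd; rewrite q0 dvdn1 => /eqP p1; have := p_prime; rewrite p1.
  rewrite -(expr0z p%:R) ler_eXz2l// subr_le0 lez_nat leqNgt.
  rewrite (@leq_ltn_trans 0)//; last first.
    by rewrite logn_gt0 mem_primes p_prime pd absz_gt0 denq_neq0.
  rewrite leqn0; apply/eqP/logn_coprime.
  by rewrite (coprime_dvdl pd)// coprime_sym coprime_num_den.
have : coprimez p (denq q) by rewrite coprimezE prime_coprime.
move=> /coprimezP[[a b] /= ab].
have pgt0 : (0 < p%:Z) by rewrite ltz_nat prime_gt0.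
pose d := ((numq q * b) %% p%:Z)%Z.
have d0 : 0 <= d by rewrite modz_ge0// gt_eqF.
have dp : (`|d| < p)%N by rewrite -ltz_nat gez0_abs// ltz_pmod.
exists (Ordinal dp); apply: (absv_distl_lt vU xq) => /=.
have dw0 : (denq q)%:~R != 0 :> F.
  rewrite -(absv_gt0 v) lt_def absv_ge0 andbT absv_eq0.
  apply: contra pden => /eqP w0.
  have : v (denq q)%:~R < 1 by rewrite w0 absv0.
  by rewrite padic_absv_int_lt1 dvdzE.
have wv1 : v (denq q)%:~R = 1.
  apply/eqP; rewrite eq_le absv_int//= leNgt padic_absv_int_lt1 dvdzE.
  exact: pden.
have -> : `|d|%N%:R = d%:~R :> F by rewrite -{2}(gez0_abs d0).
have -> : ratr q - d%:~R = (numq q - d * denq q)%:~R / (denq q)%:~R :> F.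
  by rewrite mulrzBr mulrBl -[d * _ in RHS]/(d * denq q) intrM mulfK.
rewrite absvM absvV wv1 invr1 mulr1 padic_absv_int_lt1.
have -> : numq q - d * denq q = (numq q * a + (numq q * b %/ p)%Z * denq q) * p%:Z.
  have := divz_eq (numq q * b) p; rewrite -/d => e.
  have -> : d = numq q * b - (numq q * b %/ p)%Z * p by rewrite {1}e; ring.
  rewrite -{1}[numq q]mulr1 -ab; ring.
by rewrite dvdz_mull.
Qed.

End PadicField.

(** * Digit expansions and the p-adic floor *)

Lemma geometric_lt (R : realType) (c z r : R) :
  0 <= c -> 0 <= z < 1 -> 0 < r ->
  exists N, forall n, (N <= n)%N -> c * z ^+ n < r.
Proof.
move=> c0 /andP[z0 z1] r0.
have := @cvg_geometric R c z; rewrite ger0_norm// => /(_ z1).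
move=> /cvgrPdist_lt /(_ r r0)[N _ hN]; exists N => n /hN.
by rewrite /geometric /= sub0r normrN ger0_norm// mulr_ge0 ?exprn_ge0.
Qed.

Lemma sum_digits_lt (p n : nat) (a : nat -> 'I_p) :
  (\sum_(k < n) a k * p ^ k < p ^ n)%N.
Proof.
elim: n => [|n IH]; first by rewrite big_ord0.
rewrite big_ord_recr /= expnS.
have p0 : (0 < p ^ n)%N by rewrite expn_gt0 (leq_ltn_trans _ (ltn_ord (a 0))).
have hn : (a n * p ^ n <= p.-1 * p ^ n)%N.
  by rewrite leq_mul2r; apply/orP; right; have := ltn_ord (a n); lia.
have -> : (p * p ^ n = p.-1 * p ^ n + p ^ n)%N.
  by rewrite addnC -mulSn prednK// (leq_ltn_trans _ (ltn_ord (a 0))).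
by rewrite addnC -addnS leq_add.
Qed.

Section PadicFloor.
Variables (R : realType) (p : nat) (F : fieldType) (v : absval R F).
Hypothesis p_prime : prime p.
Hypothesis F_padic : is_padic_field p v.

Let vU := padic_ultrametric p_prime F_padic.
Let p0 := padic_p_neq0 p_prime F_padic.
Let vp := padic_absv_p p_prime F_padic.
Let pR0 : 0 < p%:R :> R. Proof. by rewrite ltr0n prime_gt0. Qed.
Let pR1 : 1 < p%:R :> R. Proof. by rewrite ltr1n prime_gt1. Qed.

(* The truncated expansions [N / p ^ k] represent the cosets of the open unit
   ball; [N < p ^ k.+1] makes the representative unique. *)
Definition padic_frac (c : F) :=
  exists N k, (N < p ^ k.+1)%N /\ c = N%:R / p%:R ^+ k.

(** Over a common denominator [p ^ k], distance below 1 makes [p ^ k.+1] divide the difference of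
    the numerators, which is itself smaller than [p ^ k.+1]. *)
Lemma padic_frac_inj c d : padic_frac c -> padic_frac d -> v (c - d) < 1 -> c = d.
Proof.
wlog : c d / exists N M k,
    [/\ (N < p ^ k.+1)%N, (M <= N)%N, c = N%:R / p%:R ^+ k & d = M%:R / p%:R ^+ k].
  move=> H [N [k [Nk cE]]] [M [l [Ml dE]]] cd.
  have pp i : p%:R ^+ i != 0 :> F by rewrite expf_neq0.
  have cE' : c = (N * p ^ l)%N%:R / p%:R ^+ (k + l).
    by rewrite cE natrM natrX exprD; field; rewrite !pp.
  have dE' : d = (M * p ^ k)%N%:R / p%:R ^+ (k + l).
    by rewrite dE natrM natrX exprD; field; rewrite !pp.
  have Nkl : (N * p ^ l < p ^ (k + l).+1)%N.
    by rewrite -addSn expnD ltn_pmul2r// expn_gt0 prime_gt0.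
  have Mkl : (M * p ^ k < p ^ (k + l).+1)%N.
    by rewrite addnC -addSn expnD ltn_pmul2r// expn_gt0 prime_gt0.
  have [MN|/ltnW NM] := leqP (M * p ^ k) (N * p ^ l).
    by apply: H => //; [exists (N * p ^ l)%N, (M * p ^ k)%N, (k + l)%N |
      exists N, k | exists M, l].
  apply/esym; apply: H; rewrite 1?absvB//;
    [|by exists M, l|by exists N, k].
  by exists (M * p ^ k)%N, (N * p ^ l)%N, (k + l)%N.
move=> [N [M [k [Nk MN -> ->]]]] _ _.
move: MN; rewrite leq_eqVlt => /predU1P[->//|MN].
have D0 : (0 < N - M)%N by rewrite subn_gt0.
rewrite -mulrBl -natrB ?(ltnW MN)// absvM absvV absvX vp exprVn invrK.
rewrite (padic_absv_nat F_padic)// ltr_pdivrMl ?exprn_gt0// mulr1 ltr_eXn2l// => kD.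
have := leq_trans (leq_pexp2l (prime_gt0 p_prime) kD) (dvdn_leq D0 (pfactor_dvdnn p _)).
by rewrite leqNgt (leq_ltn_trans (leq_subr _ _)).
Qed.


(** After scaling into the closed unit ball, subtracting the digit and dividing by [p] maps this
    ball to itself, by the gap below 1. The digits along the orbit are those of the expansion. *)
Lemma padic_expansion_exists b : exists n0 a, @padic_expansion R p F v b n0 a.
Proof.
have [z [u [bE u1]]] : exists z u, b = u * p%:R ^ z /\ v u <= 1.
  have [->|b0] := eqVneq b 0; first by exists 0, 0; rewrite mul0r absv0.
  have [z vb] := padic_absv_value p_prime F_padic b0.
  exists (- z), (b * p%:R ^ z); rewrite -mulrA -expfzDr// subrr expr0z mulr1.
  split=> //; rewrite absvM vb absvXz vp exprz_inv -invr_expz mulfV//.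
  by rewrite expfz_neq0// gt_eqF.
have [dig digP] : exists dig : F -> 'I_p,
    forall x, v x <= 1 -> v (x - (dig x)%:R) < 1.
  have : forall x, exists d : 'I_p, v x <= 1 -> v (x - d%:R) < 1.
    move=> x; have [x1|x1] := boolP (v x <= 1); last first.
      by exists (Ordinal (prime_gt0 p_prime)) => x1'; case/negP: x1.
    by have [d dx] := padic_digit p_prime F_padic x1; exists d.
  by move=> /boolp.choice[dig digP]; exists dig.
pose rem x := (x - (dig x)%:R) / p%:R.
have rem1 k : v (iter k rem u) <= 1.
  elim: k => //= k IH; rewrite /rem absvM absvV vp invrK -ler_pdivlMr// mul1r.
  by rewrite -(padic_absv_lt1 p_prime F_padic) digP.
pose a k := dig (iter k rem u).
exists z, a; apply/vspace_cvgP => r r0.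
have eqn n : b - \sum_(k < n) (a k)%:R * p%:R ^ (z + k%:Z) =
    iter n rem u * p%:R ^+ n * p%:R ^ z.
  elim: n => [|n IH]; first by rewrite big_ord0 subr0 expr0 mulr1.
  rewrite big_ord_recr /= opprD addrA IH expfzDr// -exprnP /rem exprS.
  rewrite -/(a n); field; rewrite p0 //.
have [||N hN] := @geometric_lt R (v (p%:R ^ z)) p%:R^-1 r _ _ r0.
- exact: absv_ge0.
- by rewrite invr_ge0 ler0n invf_lt1.
exists N => n /hN; apply: le_lt_trans.
rewrite eqn !absvM mulrC ler_wpM2l ?absv_ge0// absvX vp.
by rewrite ler_piMl ?exprn_ge0 ?invr_ge0 ?ler0n.
Qed.

(** The bound [|n0|.+1] loses nothing, because [n0 + k <= 0] forces [k <= |n0|]. All other terms of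
    a partial sum have positive exponents, so their sum stays in the open unit ball. *)
Lemma padic_expansion_floor b n0 (a : nat -> 'I_p)
    (c : F := \sum_(k < `|n0|.+1 | n0 + k%:Z <= 0) (a k)%:R * p%:R ^ (n0 + k%:Z)) :
  @padic_expansion R p F v b n0 a -> v (b - c) < 1 /\ padic_frac c.
Proof.
pose t k : F := (a k)%:R * p%:R ^ (n0 + k%:Z).
move=> /vspace_cvgP /(_ 1 ltr01)[N hN]; split.
  pose n := maxn N `|n0|.+1.
  apply: (absv_distl_lt vU (hN n (leq_maxl _ _))).
  rewrite (bigID (fun k : 'I_n => n0 + k%:Z <= 0)) /=.
  have -> : \sum_(i < n | n0 + i%:Z <= 0) t i = c.
    rewrite -(big_mkord (fun k : nat => n0 + k%:Z <= 0) t).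
    rewrite (@big_cat_nat _ _ _ `|n0|.+1) ?leq_maxr//=.
    rewrite big_mkord [X in _ + X]big_nat_cond big_pred0 ?addr0//.
    by move=> k; apply/negbTE; lia.
  rewrite addrAC subrr add0r; apply: absv_sum_lt => // k k0.
  rewrite (padic_absv_lt1 p_prime F_padic) absvM -[leRHS]mul1r.
  rewrite ler_pM ?absv_ge0 ?(padic_absv_natr_le1 p_prime F_padic)//.
  rewrite absvXz vp exprz_inv -invr_expz lef_pV2 ?posrE ?exprz_gt0//.
  by rewrite -[leLHS]expr1z ler_eXz2l//; lia.
have [n0_gt0|n0_le0] := ltP 0 n0.
  exists 0%N, 0%N; rewrite expn1 prime_gt0// mul0r; split=> //.
  by rewrite /c big_pred0// => k; apply/negbTE; lia.
pose M := `|n0|%N; exists (\sum_(k < M.+1) a k * p ^ k)%N, M; split.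
  exact: sum_digits_lt.
rewrite /c natr_sum mulr_suml; apply: eq_big => [k|k _].
  by have := ltn_ord k; lia.
rewrite natrM natrX -mulrA; congr (_ * _).
rewrite expfzDr// -exprnP mulrC; congr (_ * _).
by rewrite exprnN; congr (_ ^ _); rewrite /M; lia.
Qed.

(** Existence of an expansion excludes the default of [xget]. Whichever expansion is picked, these
    two properties hold, and by [padic_frac_inj] they determine the floor. *)
Lemma padic_floorP b :
  v (b - padic_floor p v b) < 1 /\ padic_frac (padic_floor p v b).
Proof.
have [n0 [a ba]] := padic_expansion_exists b.
rewrite /padic_floor; set P := [set c : F | _].
have [|m0 [d [bd ->]]] := @xgetPex _ 0 P; first by eexists; exists n0, a.
exact: padic_expansion_floor.
Qed.

Lemma padic_floor_eq b c : v (b - c) < 1 -> padic_floor p v b = padic_floor p v c.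
Proof.
have [bb bF] := padic_floorP b; have [cc cF] := padic_floorP c.
move=> bc; apply: padic_frac_inj => //.
by apply: (absv_distl_lt vU (y := b)); [rewrite absvB|exact: absv_distl_lt bc cc].
Qed.

(** Completeness in the form that successive approximation calls for: in an ultrametric field small
    terms already make the partial sums Cauchy. *)
Lemma padic_series_cvg (t : nat -> F) (c z : R) :
    0 <= c -> 0 <= z < 1 -> (forall k, v (t k) <= c * z ^+ k) ->
  exists l, forall r, 0 < r ->
    exists N, forall n, (N <= n)%N -> v (l - \sum_(k < n) t k) < r.
Proof.
move=> c0 z01 tz; have [_ _ complete] := F_padic.
pose S n : vspace v := \sum_(k < n) t k : F.
have S_cvg : cvg (S n @[n --> \oo]).
  apply: complete; apply/cauchyP => r r0.
  have [N hN] := geometric_lt c0 z01 r0.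
  exists (S N); exists N => // n /= Nn; rewrite vspace_ballE absvB.
  have -> : (S n : F) - S N = \sum_(N <= k < n) t k.
    rewrite /S -(big_mkord xpredT t) -(big_mkord xpredT t) (@big_cat_nat _ _ _ N)//=.
    by rewrite addrAC subrr add0r.
  rewrite big_nat; apply: (absv_sum_lt vU) => // k /andP[Nk _].
  exact: le_lt_trans (tz k) (hN _ Nk).
by exists (lim (S n @[n --> \oo])); apply/vspace_cvgP.
Qed.

End PadicFloor.

Lemma ord_argmax (R : realType) n (g : 'I_n -> R) :
  (0 < n)%N -> exists i, forall j, g j <= g i.
Proof.
case: n g => // n g _.
by case: (@arg_maxP _ _ _ (ord0 : 'I_n.+1) xpredT g isT) => i _ h; exists i => j; exact: h.
Qed.

Section Extension.
Variables (R : realType) (p : nat) (F : fieldType) (vF : absval R F).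
Variables (K : fieldExtType F) (vK : absval R K).
Hypothesis p_prime : prime p.
Hypothesis F_padic : is_padic_field p vF.
Hypothesis vK_ext : forall c : F, vK c%:A = vF c.

Let FU := padic_ultrametric p_prime F_padic.
Let natF1 := padic_absv_natr_le1 p_prime F_padic.
Let pR0 : 0 < p%:R :> R. Proof. by rewrite ltr0n prime_gt0. Qed.
Let pR1 : 1 < p%:R :> R. Proof. by rewrite ltr1n prime_gt1. Qed.

Lemma ext_absvZ c x : vK (c *: x) = vF c * vK x.
Proof. by rewrite -mulr_algl absvM vK_ext. Qed.

Lemma ext_absv_nat n : vK n%:R = vF n%:R.
Proof. by rewrite -vK_ext scaler_nat. Qed.

Lemma ext_ultrametric : ultrametric vK.
Proof.
apply: ultrametric_nat => n; rewrite ext_absv_nat.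
exact: natF1.
Qed.

Let KU := ext_ultrametric.

(** * Residue field and value group of the extension *)

Section ResidueField.
Variables (f : nat) (gamma : K).
Hypothesis gamma_prim : (p ^ f - 1)%N.-primitive_root gamma.

Lemma residue_degree_gt0 : (0 < f)%N.
Proof. by have := prim_order_gt0 gamma_prim; case: f => //; rewrite subnn. Qed.

Lemma absv_gammaX k : vK (gamma ^+ k) = 1.
Proof.
rewrite absvX (@absv_root1 _ _ vK gamma (p ^ f - 1)) ?expr1n//.
  exact: prim_order_gt0 gamma_prim.
exact: prim_expr_order.
Qed.

(* Evaluating [(X^n - 1) / (X - 1)] at [1] gives
   [\prod_(1 <= k < n) (1 - gamma ^+ k) = n], a unit for [n = p ^ f - 1]. *)
Lemma absv_1B_gammaX k : (0 < k < p ^ f - 1)%N -> vK (1 - gamma ^+ k) = 1.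
Proof.
set n := (p ^ f - 1)%N => /andP[k0 kn].
have vn : vK n%:R = 1.
  rewrite ext_absv_nat; apply/eqP; rewrite eq_le natF1/=.
  rewrite leNgt (padic_absv_nat_lt1 p_prime F_padic); apply/negP => pn.
  have : (p %| p ^ f - n)%N.
    by rewrite dvdn_sub// dvdn_exp// residue_degree_gt0.
  rewrite subKn ?expn_gt0 ?prime_gt0// dvdn1 => /eqP p1.
  by have := p_prime; rewrite p1.
have le1 i : vK (1 - gamma ^+ i) <= 1 by rewrite absvB_le ?absv1 ?absv_gammaX.
have prodE : \prod_(1 <= i < n) (1 - gamma ^+ i) = n%:R.
  have := factor_Xn_sub_1 gamma_prim; rewrite -/n.
  rewrite big_ltn ?(leq_trans _ kn)// subrX1 expr0 => /mulfI.
  rewrite polyXsubC_eq0 => /(_ isT) /(congr1 (horner^~ 1)).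
  rewrite horner_prod horner_sum => h.
  transitivity (\prod_(1 <= i < n) ('X - (gamma ^+ i)%:P).[1]).
    by apply: eq_bigr => i _; rewrite !hornerE.
  rewrite h (eq_bigr (fun=> 1)) ?sumr_const ?card_ord// => i _.
  by rewrite !hornerE expr1n.
apply/eqP; rewrite eq_le le1 /= leNgt; apply/negP => lt1.
suff : vK n%:R < 1 by rewrite vn ltxx.
rewrite -prodE (bigD1_seq k) ?mem_index_iota ?iota_uniq ?k0//=.
rewrite absvM (le_lt_trans _ lt1)// ler_piMr ?absv_ge0//.
elim/big_ind: _ => [|x y x1 y1|i _]; rewrite ?absv1//.
by rewrite absvM -[leRHS]mul1r ler_pM ?absv_ge0.
Qed.

Lemma absv_gammaX_dist (i j : nat) :
  (i < p ^ f - 1)%N -> (j < p ^ f - 1)%N -> vK (gamma ^+ i - gamma ^+ j) < 1 -> i = j.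
Proof.
wlog ij : i j / (i <= j)%N.
  move=> H hi hj ij1; have [/H->//|/ltnW/H->//] := leqP i j.
  by rewrite absvB.
move=> _ jn; rewrite -[in gamma ^+ j](subnKC ij) exprD -[X in X - _]mulr1 -mulrBr.
rewrite absvM absv_gammaX mul1r; apply: contraTeq => nij.
by rewrite absv_1B_gammaX ?ltxx//; lia.
Qed.

Lemma digit_inj (c d : 'I_p) : vF (c%:R - d%:R) < 1 -> c = d.
Proof.
have -> : c%:R - d%:R = (c%:Z - d%:Z)%:~R :> F by rewrite rmorphB.
rewrite (padic_absv_int_lt1 p_prime F_padic) -eqz_mod_dvd !modz_nat !modn_small//.
by move=> /eqP[/val_inj].
Qed.

(** Rounding integral coefficients to digits leaves finitely many combinations, as the counting
    arguments below require. *)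
Lemma digits_approx n (z : 'I_n -> K) (c : 'I_n -> F) :
    (forall i, vK (z i) <= 1) -> (forall i, vF (c i) <= 1) ->
  exists d : {ffun 'I_n -> 'I_p},
    vK (\sum_i c i *: z i - \sum_i (d i)%:R *: z i) < 1.
Proof.
move=> z1 c1; have /boolp.choice[d dP] := fun i => padic_digit p_prime F_padic (c1 i).
exists [ffun i => d i]; rewrite -sumrB; apply: absv_sum_lt => // i _.
rewrite ffunE -scalerBl ext_absvZ.
by rewrite (le_lt_trans _ (dP i))// ler_piMr ?absv_ge0.
Qed.

(* If the residues of [1, .., gamma ^+ d] were dependent for some [d < f], they
   would leave at most [p ^ d] residue classes for [0] and the [p ^ f - 1]
   pairwise incongruent powers of [gamma]. *)
Lemma gamma_residue_free (c : 'I_f -> F) :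
    (forall i, vF (c i) <= 1) -> vK (\sum_i c i *: gamma ^+ i) < 1 ->
  forall i, vF (c i) < 1.
Proof.
move=> c1 sum1 i0; rewrite ltNge; apply/negP => ci0.
(* [d] is the last index with a unit coefficient. The later terms are negligible, so dividing by
   [c d] makes [gamma ^+ d] congruent to an integral combination of lower powers. *)
case: (@arg_maxnP _ i0 (fun i => 1 <= vF (c i)) (fun i : 'I_f => i : nat) ci0).
move=> d cd dmax.
have {ci0 dmax} clt (i : 'I_f) : (d < i)%N -> vF (c i) < 1.
  by move=> di; rewrite ltNge; apply/negP => /dmax /=; rewrite /geq /= leqNgt di.
have {}cd : vF (c d) = 1 by apply/eqP; rewrite eq_le c1 cd.
have cd0 : c d != 0 by rewrite -(absv_gt0 vF) cd.
have [a a1 ga] : exists2 a : 'I_d -> F, (forall i, vF (a i) <= 1) &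
    vK (gamma ^+ d - \sum_(i < d) a i *: gamma ^+ i) < 1.
  pose g i := if insub i is Some j then c j else 0.
  have gE (i : 'I_f) : g i = c i by rewrite /g valK.
  exists (fun i => - (g i / c d)) => [i|].
    rewrite absvN absvM absvV cd invr1 mulr1 /g; case: insubP => [j _ _|_] //.
    by rewrite absv0.
  have -> : gamma ^+ d - \sum_(i < d) - (g i / c d) *: gamma ^+ i =
      (c d)^-1 *: (\sum_(i < d) g i *: gamma ^+ i + g d *: gamma ^+ d).
    rewrite scalerDr gE scalerA mulVf// scale1r addrC; congr (_ + _).
    rewrite scaler_sumr -sumrN; apply: eq_bigr => i _.
    by rewrite scaleNr opprK scalerA mulrC.
  rewrite ext_absvZ absvV cd invr1 mul1r -(big_ord_recr d (fun i => g i *: gamma ^+ i)) /=.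
  have -> : \sum_(i < d.+1) g i *: gamma ^+ i = \sum_(i < f) c i *: gamma ^+ i -
      \sum_(i < f | (d < i)%N) c i *: gamma ^+ i.
    rewrite [X in X - _](bigID (fun i : 'I_f => (d < i)%N)) /= addrAC subrr add0r.
    rewrite (big_ord_widen_cond _ xpredT (fun i => g i *: gamma ^+ i) (ltn_ord d)) /=.
    by apply: eq_big => [i|i _]; rewrite ?gE// -leqNgt ltnS.
  apply: absvB_lt => //; apply: absv_sum_lt => // i di.
  by rewrite ext_absvZ absv_gammaX mulr1 clt.
(* The elements congruent to integral combinations of [gamma ^+ i], [i < d]. By the relation for
   [gamma ^+ d] all powers of [gamma] belong to them. *)
pose spanned y := exists2 b : 'I_d -> F, (forall i, vF (b i) <= 1) &
  vK (y - \sum_(i < d) b i *: gamma ^+ i) < 1.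
have spannedD x y : spanned x -> spanned y -> spanned (x + y).
  move=> [b b1 xb] [b' b'1 yb']; exists (fun i => b i + b' i) => [i|].
    exact: absvD_le.
  rewrite (_ : _ - _ = x - \sum_(i < d) b i *: gamma ^+ i +
    (y - \sum_(i < d) b' i *: gamma ^+ i)); first exact: absvD_lt.
  rewrite addrACA -opprD -big_split; congr (_ - _).
  by apply: eq_bigr => i _; rewrite scalerDl.
have spannedZ (t : F) y : vF t <= 1 -> spanned y -> spanned (t *: y).
  move=> t1 [b b1 yb]; exists (fun i => t * b i) => [i|].
    by rewrite absvM mulr_ile1 ?absv_ge0.
  rewrite (eq_bigr (fun i : 'I_d => t *: (b i *: gamma ^+ i))) => [|i _]; last first.
    by rewrite scalerA.
  rewrite -scaler_sumr -scalerBr ext_absvZ.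
  by rewrite (le_lt_trans _ yb)// ler_piMl ?absv_ge0.
have spanned0 y : vK y < 1 -> spanned y.
  move=> y1; exists (fun=> 0) => [i|]; first by rewrite absv0.
  by rewrite big1 ?subr0// => i _; rewrite scale0r.
have spannedX i : (i <= d)%N -> spanned (gamma ^+ i).
  rewrite leq_eqVlt => /predU1P[->|id]; first by exists a.
  exists (fun j => (j == Ordinal id)%:R) => [j|].
    by case: eqP => _; rewrite ?absv1 ?absv0.
  rewrite (bigD1 (Ordinal id))//= eqxx scale1r big1 ?addr0 ?subrr ?absv0// => j.
  by move=> /negPf ->; rewrite scale0r.
have red k : exists h : {ffun 'I_d -> 'I_p},
    vK (gamma ^+ k - \sum_i (h i)%:R *: gamma ^+ i) < 1.
  suff [b b1 gb] : spanned (gamma ^+ k).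
    have [|h hP] := @digits_approx d (fun i => gamma ^+ i) b _ b1.
      by move=> i; rewrite absv_gammaX.
    by exists h; exact: (absv_distl_lt KU gb).
  elim: k => [|k [b b1 gb]]; first exact: spannedX.
  rewrite exprS -[gamma ^+ k](subrK (\sum_(i < d) b i *: gamma ^+ i)) mulrDr.
  apply: (spannedD).
    by apply: spanned0; rewrite absvM -[gamma]expr1 absv_gammaX mul1r.
  rewrite mulr_sumr; elim/big_ind: _ => [||i _]; [|exact: spannedD|].
    by apply: spanned0; rewrite absv0.
  by rewrite -scalerAr -exprS; apply: spannedZ => //; exact: spannedX.
have /boolp.choice[h hP] := red.
pose P0 : 'I_p := Ordinal (prime_gt0 p_prime).
(* [None] stands for the zero residue class, which brings the number of classes to exactly
   [p ^ f]. *)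
pose g (k : option 'I_(p ^ f - 1)) : {ffun 'I_d -> 'I_p} :=
  if k is Some k' then h k' else [ffun=> P0].
have hN0 k : h k != [ffun=> P0].
  apply/eqP => hk0; have := hP k; rewrite hk0 big1 => [|i _].
    by rewrite subr0 absv_gammaX ltxx.
  by rewrite ffunE scale0r.
have g_inj : injective g.
  move=> [i|] [j|] //= h_eq.
  - congr Some; apply/val_inj/absv_gammaX_dist; rewrite ?ltn_ord//=.
    by apply: (absv_distl_lt KU (hP i)); rewrite absvB h_eq.
  - by have := hN0 i; rewrite h_eq eqxx.
  - by have := hN0 j; rewrite -h_eq eqxx.
have := leq_card g g_inj; rewrite card_option card_ffun !card_ord.
rewrite subn1 prednK ?expn_gt0 ?prime_gt0// leq_exp2l ?prime_gt1//.
by rewrite leqNgt ltn_ord.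
Qed.

Lemma gamma_digits_inj (c d : {ffun 'I_f -> 'I_p}) :
  vK (\sum_i (c i)%:R *: gamma ^+ i - \sum_i (d i)%:R *: gamma ^+ i) < 1 -> c = d.
Proof.
rewrite -sumrB (eq_bigr (fun i => ((c i)%:R - (d i)%:R) *: gamma ^+ i)) => [cd|i _].
  apply/ffunP => i; apply: digit_inj; apply: gamma_residue_free cd i => i.
  by apply: absvB_le => //; exact: natF1.
by rewrite scalerBl.
Qed.

(** Writing each digit combination of the powers of [gamma] in the basis given by [resK] is an
    injection of a finite set of digit functions into itself, hence onto. *)
Lemma gamma_digits_exist (resK : residue_degree vF vK {:K}%AS f) y : vK y <= 1 ->
  exists c : {ffun 'I_f -> 'I_p}, vK (y - \sum_i (c i)%:R *: gamma ^+ i) < 1.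
Proof.
move=> y1; have [x [x1 xP _]] := resK.
have dig z : vK z <= 1 -> exists h : {ffun 'I_f -> 'I_p},
    vK (z - \sum_i (h i)%:R *: x i) < 1.
  move=> z1; have [c c1 zc] := xP z (memvf _) z1.
  have [|h hP] := @digits_approx f x c _ c1; first by move=> i; have [] := x1 i.
  by exists h; exact: (absv_distl_lt KU zc).
pose s (c : {ffun 'I_f -> 'I_p}) := \sum_i (c i)%:R *: gamma ^+ i.
have s1 c : vK (s c) <= 1.
  apply: absv_sum_le => // i _; rewrite ext_absvZ absv_gammaX mulr1.
  exact: natF1.
have /boolp.choice[h hP] := fun c => dig (s c) (s1 c).
have h_inj : injective h.
  move=> c d cd; apply: gamma_digits_inj; apply: (absv_distl_lt KU (hP c)).
  by rewrite cd absvB; exact: hP.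
have [k yk] := dig y y1.
have /codomP[c kc] : k \in codom h by exact: (injF_onto h_inj).
by exists c; apply: (absv_distl_lt KU yk); rewrite kc absvB; exact: hP.
Qed.

(** Dividing by a coefficient of largest value reduces the lower bound to [gamma_residue_free]. The
    value is presented as that of some [a : F] so that its coset modulo the value group of [F] is
    visible. *)
Lemma gamma_comb_absv (c : 'I_f -> F) : exists a : F,
  vK (\sum_j c j *: gamma ^+ j) = vF a /\ forall j, vF (c j) <= vF a.
Proof.
have [j0 cmax] : exists j0, forall j, vF (c j) <= vF (c j0).
  exact: (ord_argmax (fun j => vF (c j)) residue_degree_gt0).
have le1 : vK (\sum_j c j *: gamma ^+ j) <= vF (c j0).
  apply: absv_sum_le => // [|j _]; first exact: absv_ge0.
  by rewrite ext_absvZ absv_gammaX mulr1.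
exists (c j0); split=> //; apply/eqP; rewrite eq_le le1 leNgt; apply/negP => lt1.
have c0 : c j0 != 0 by rewrite -(absv_gt0 vF) (le_lt_trans (absv_ge0 _ _) lt1).
have vc0 : 0 < vF (c j0) by rewrite absv_gt0.
have := @gamma_residue_free (fun j => c j / c j0).
have -> : \sum_j (c j / c j0) *: gamma ^+ j = (c j0)^-1 *: \sum_j c j *: gamma ^+ j.
  by rewrite scaler_sumr; apply: eq_bigr => j _; rewrite scalerA mulrC.
rewrite ext_absvZ absvV ltr_pdivrMl// mulr1 lt1 => h.
have /h/(_ isT j0) : forall j, vF (c j / c j0) <= 1.
  by move=> j; rewrite absvM absvV ler_pdivrMr// mul1r.
by rewrite divff// absv1 ltxx.
Qed.

End ResidueField.

Section Ramification.
Variables (e : nat) (beta : K).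
Hypothesis ramK : ramification_index vF vK {:K}%AS e.
Hypothesis abs_beta : vK beta = p%:R `^ e%:R^-1.

Lemma ramification_index_gt0 : (0 < e)%N.
Proof.
have [x [_ /(_ 1 (memvf _) (oner_neq0 _))[i _]]] := ramK.
exact: leq_ltn_trans (leq0n i) (ltn_ord i).
Qed.

Let B := vK beta.

Lemma absv_betaX : B ^+ e = p%:R.
Proof.
rewrite /B abs_beta -powR_mulrn ?powR_ge0// -powRrM mulVf ?powRr1 ?ler0n//.
by rewrite pnatr_eq0 -lt0n ramification_index_gt0.
Qed.

Lemma absv_beta_gt1 : 1 < B.
Proof.
by rewrite -(@expr_gt1 _ e) ?absv_ge0 ?absv_betaX//; exact: ramification_index_gt0.
Qed.

Let B1 := absv_beta_gt1.
Let B0 : 0 < B. Proof. exact: lt_trans B1. Qed.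

Lemma beta_neq0 : beta != 0.
Proof. by rewrite -(absv_gt0 vK). Qed.

(** Since [p = B ^+ e], both sides are powers of [B]; the exponents agree modulo [e], while [i] and
    [j] are below [e]. *)
Lemma coset_beta_inj (i j : 'I_e) (c d : F) :
  c != 0 -> d != 0 -> vF c * B ^+ i = vF d * B ^+ j -> i = j.
Proof.
move=> /(padic_absv_value p_prime F_padic)[y ->].
move=> /(padic_absv_value p_prime F_padic)[z ->].
rewrite -absv_betaX !exprnP !exprz_exp -!expfzDr ?gt_eqF//.
move=> /(ieexprIz B0 (negbT (gt_eqF B1))) /(congr1 (modz^~ e%:Z)).
by rewrite ![e%:Z * _]mulrC !modzMDl !modz_nat !modn_small// => -[/val_inj].
Qed.

(** The [e] powers [B ^+ i] lie in distinct cosets of the value group of [F], of which there are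
    only [e], so they meet every coset. *)
Lemma absv_beta_value y :
  y != 0 -> exists (i : 'I_e) (c : F), c != 0 /\ vK y = vF c * B ^+ i.
Proof.
move=> y0; have [x [x0 xP]] := ramK.
have sP i : exists k, exists2 c : F, c != 0 & B ^+ i = vK (x k) * vF c.
  rewrite -absvX; have [|k [kP _]] := xP (beta ^+ i) (memvf _); last by exists k.
  by rewrite expf_neq0// beta_neq0.
have /boolp.choice[s {}sP] := fun i : 'I_e => sP i.
have s_inj : injective s.
  move=> i j ij; have [c c0 ic] := sP i; have [d d0 jd] := sP j.
  apply: (@coset_beta_inj _ _ d c) => //.
  by rewrite ic jd ij; ring.
have [k [[c c0 yc] _]] := xP y (memvf _) y0.
have /codomP[i ki] : k \in codom s by exact: (injF_onto s_inj).
have [d d0 id] := sP i; exists i, (c / d); split; first by rewrite mulf_neq0 ?invr_eq0.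
have d0' : vF d != 0 by rewrite absv_eq0.
by rewrite yc id ki absvM absvV; field.
Qed.

Lemma absv_beta_pow y : y != 0 -> exists z : int, vK y = B ^ z.
Proof.
move=> /absv_beta_value[i [c [/(padic_absv_value p_prime F_padic)[z ->] ->]]].
exists (e%:Z * z + i%:Z).
by rewrite -absv_betaX expfzDr ?gt_eqF// exprnP exprz_exp.
Qed.

End Ramification.

(** * The expansion along gamma ^+ j * beta ^+ i *)

Section Floor.
Variables (e f : nat) (gamma beta : K).
Hypothesis ramK : ramification_index vF vK {:K}%AS e.
Hypothesis resK : residue_degree vF vK {:K}%AS f.
Hypothesis gamma_prim : (p ^ f - 1)%N.-primitive_root gamma.
Hypothesis abs_beta : vK beta = p%:R `^ e%:R^-1.

Let e0 := ramification_index_gt0 ramK.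
Let gammaX := absv_gammaX gamma_prim.
Let gamma_comb := gamma_comb_absv gamma_prim.
Let gamma_digits := gamma_digits_exist gamma_prim resK.
Let B := vK beta.
Let BX : B ^+ e = p%:R := absv_betaX ramK abs_beta.
Let B1 : 1 < B := absv_beta_gt1 ramK abs_beta.
Let B0 : 0 < B. Proof. exact: lt_trans B1. Qed.
Let beta_neq0 : beta != 0. Proof. by rewrite -(absv_gt0 vK). Qed.
Let beta_value := absv_beta_value ramK abs_beta.
Let beta_pow := absv_beta_pow ramK abs_beta.

Notation lincomb := (@lincomb F K e f gamma beta).

Lemma lincombB b c : lincomb b - lincomb c = lincomb (fun i j => b i j - c i j).
Proof.
rewrite /lincomb -sumrB; apply: eq_bigr => i _; rewrite -sumrB.
by apply: eq_bigr => j _; rewrite scalerBl.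
Qed.

Lemma lincombE b :
  lincomb b = \sum_(i < e) (\sum_(j < f) b i j *: gamma ^+ j) * beta ^+ i.
Proof.
apply: eq_bigr => i _; rewrite mulr_suml; apply: eq_bigr => j _.
by rewrite scalerAl.
Qed.

(* The nonzero terms lie in distinct cosets of the value group of [F], so the
   largest one is not cancelled. *)
Lemma lincomb_coef_le b (i : 'I_e) (j : 'I_f) : vF (b i j) * B ^+ i <= vK (lincomb b).
Proof.
have /boolp.choice[a aP] := fun i => gamma_comb (b i).
pose t i := (\sum_(j < f) b i j *: gamma ^+ j) * beta ^+ i.
have vt k : vK (t k) = vF (a k) * B ^+ k by rewrite absvM absvX (aP k).1.
have [i0 tmax] := ord_argmax (fun k => vK (t k)) e0.
apply: (@le_trans _ _ (vK (t i0))).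
  by rewrite (le_trans _ (tmax i))// vt ler_wpM2r ?exprn_ge0 ?(ltW B0)// (aP i).2.
have [->|t0] := eqVneq (t i0) 0; first by rewrite absv0 absv_ge0.
rewrite le_eqVlt; apply/orP; left; apply/eqP/esym/(absv_near KU).
rewrite lincombE (bigD1 i0)//= addrAC subrr add0r.
apply: (absv_sum_lt KU) => [|k ki0]; first by rewrite absv_gt0.
rewrite -/(t k) lt_neqAle tmax andbT; apply: contra ki0 => /eqP tk.
have ak : a k != 0.
  rewrite -(absv_eq0 vF); apply: contra t0 => /eqP ak.
  by rewrite -(absv_eq0 vK) -tk vt ak mul0r.
have ai0 : a i0 != 0.
  rewrite -(absv_eq0 vF); apply: contra t0 => /eqP ai.
  by rewrite -(absv_eq0 vK) vt ai mul0r.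
by apply/eqP; apply: (coset_beta_inj ramK abs_beta ak ai0); rewrite -!vt.
Qed.

(** By the gap each coefficient has value at most [1/p = B ^- e], which outweighs [B ^+ i] for
    [i < e]. *)
Lemma lincomb_absv_lt1 b : (forall i j, vF (b i j) < 1) -> vK (lincomb b) < 1.
Proof.
move=> b1; apply: (absv_sum_lt KU) => // i _; apply: (absv_sum_lt KU) => // j _.
rewrite ext_absvZ absvM gammaX mul1r absvX.
have := b1 i j; rewrite (padic_absv_lt1 p_prime F_padic) -BX => h.
rewrite (le_lt_trans (ler_wpM2r _ h)) ?exprn_ge0 ?(ltW B0)//.
by rewrite ltr_pdivrMl ?exprn_gt0// mulr1 ltr_eXn2l.
Qed.

Lemma lincomb_absv_le b r : 0 <= r -> (forall i j, vF (b i j) <= r) ->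
  vK (lincomb b) <= r * p%:R.
Proof.
move=> r0 br; apply: (absv_sum_le KU) => [|i _]; first by rewrite mulr_ge0.
apply: (absv_sum_le KU) => [|j _]; first by rewrite mulr_ge0.
rewrite ext_absvZ absvM gammaX mul1r absvX -BX.
by rewrite ler_pM ?absv_ge0 ?exprn_ge0 ?(ltW B0)// ler_eXn2l// ltnW.
Qed.

(** One term in [beta ^+ i] matches the value of [x], and the digits of its unit part match the
    leading residue. *)
Lemma lincomb_approx x : exists b : 'I_e -> 'I_f -> F,
  vK (x - lincomb b) <= vK x / B /\ forall i j, vF (b i j) <= vK x.
Proof.
have [->|x0] := eqVneq x 0.
  exists (fun _ _ => 0); split=> [|i j]; rewrite !absv0// mul0r.
  rewrite /lincomb big1 ?subr0 ?absv0// => i _.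
  by rewrite big1// => j _; rewrite scale0r.
have [i [c [c0 xc]]] := beta_value x0.
have Bi : beta ^+ i != 0 by rewrite expf_neq0// beta_neq0.
have vx0 : 0 < vK x by rewrite absv_gt0.
have vBi : 0 < B ^+ i by rewrite exprn_gt0.
have vc0 : 0 < vF c by rewrite absv_gt0.
pose y := c^-1 *: (x / beta ^+ i).
have xy : x = c *: (y * beta ^+ i).
  by rewrite scalerAl /y scalerA divff// scale1r divfK.
have y1 : vK y <= 1.
  rewrite ext_absvZ absvM !absvV absvX -/B xc.
  by rewrite mulfK ?gt_eqF// mulVf ?gt_eqF.
have [d yd] := gamma_digits y1.
pose b k j := if k == i then c * (d j)%:R else 0.
have lb : lincomb b = c *: ((\sum_j (d j)%:R *: gamma ^+ j) * beta ^+ i).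
  rewrite lincombE (bigD1 i)//= [X in _ + X]big1 ?addr0 => [|k /negPf ki].
    rewrite scalerAl scaler_sumr; congr (_ * _); apply: eq_bigr => j _.
    by rewrite /b eqxx scalerA.
  by rewrite big1 ?mul0r// => j _; rewrite /b ki scale0r.
exists b; split=> [|k j]; last first.
  rewrite /b; case: eqP => _; last by rewrite absv0 absv_ge0.
  rewrite absvM xc ler_pM ?absv_ge0// (le_trans (natF1 _))// exprn_ege1// ltW//.
have lt_x : vK (x - lincomb b) < vK x.
  rewrite lb {1}xy -scalerBr -mulrBl ext_absvZ absvM absvX xc ltr_pM2l//.
  by rewrite gtr_pMl.
have [->|] := eqVneq (x - lincomb b) 0; first by rewrite absv0 divr_ge0// ltW.
(* Both values are powers of [B], so a strict decrease is a decrease by the factor [B] at least. *)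
move: lt_x => /[swap] /beta_pow[z ->]; have [w ->] := beta_pow x0.
rewrite ltr_eXz2l// => zw.
have -> : B ^ w / B = B ^ (w - 1) by rewrite expfzDr ?gt_eqF.
by rewrite ler_eXz2l// lerBrDr lezD1.
Qed.

(** Successive approximation: the corrections to each coefficient are dominated by a geometric
    series, and their sums give the coefficients of [x]. *)
Lemma lincomb_surj x : exists b, x = lincomb b.
Proof.
have /boolp.choice[ap apP] := lincomb_approx.
pose xs n := iter n (fun y => y - lincomb (ap y)) x.
have xs_le n : vK (xs n) <= vK x * B^-1 ^+ n.
  elim: n => [|n IH]; first by rewrite expr0 mulr1.
  rewrite /xs iterS -/(xs n) (le_trans (apP _).1)// exprSr mulrA.
  by rewrite ler_wpM2r// invr_ge0 ltW.
pose S n i j := \sum_(k < n) ap (xs k) i j.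
have xS n : x - lincomb (S n) = xs n.
  elim: n => [|n IH].
    rewrite /lincomb big1 ?subr0// => i _.
    by rewrite big1// => j _; rewrite /S big_ord0 scale0r.
  rewrite /xs iterS -/(xs n) -{1}IH -addrA -opprD; congr (_ - _).
  rewrite /lincomb -big_split; apply: eq_bigr => i _.
  rewrite -big_split; apply: eq_bigr => j _.
  by rewrite /S big_ord_recr scalerDl.
have Bz : 0 <= B^-1 < 1 by rewrite invr_ge0 (ltW B0) invf_lt1.
have lim (ij : 'I_e * 'I_f) : exists l, forall r, 0 < r ->
    exists N, forall n, (N <= n)%N -> vF (l - S n ij.1 ij.2) < r.
  case: ij => i j.
  have := @padic_series_cvg _ _ _ _ p_prime F_padic (fun k => ap (xs k) i j)
    _ _ (absv_ge0 vK x) Bz.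
  by apply=> k; exact: le_trans ((apP _).2 i j) (xs_le k).
have /boolp.choice[b bP] := lim.
exists (fun i j => b (i, j)); apply/eqP.
rewrite -subr_eq0 -(absv_eq0 vK) eq_le absv_ge0 andbT.
apply/ler_addgt0Pr => r r0; rewrite add0r.
(* The division by [p] offsets the factor [p] of [lincomb_absv_le]. *)
have rp : 0 < r / p%:R by rewrite divr_gt0.
have [N0 hN0] := geometric_lt (absv_ge0 vK x) Bz r0.
have /boolp.choice[N hN] := fun ij => bP ij _ rp.
pose n := maxn N0 (\max_ij N ij).
rewrite -(subrKA (lincomb (S n))); apply: (absvD_le KU).
  by rewrite xS (le_trans (xs_le n))// ltW// hN0// leq_maxl.
rewrite lincombB -[leRHS](@divfK _ p%:R) ?gt_eqF//.
apply: lincomb_absv_le => [|i j]; first exact: ltW.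
rewrite absvB ltW// (hN (i, j))// (leq_trans _ (leq_maxr _ _))//.
exact: leq_bigmax.
Qed.

Notation ext_floor := (ext_floor p vF e f gamma beta).

(** [xget] may choose other coefficients [b'], but the orthogonality bound applied to [b' - b] shows
    that they agree with [b]. *)
Lemma ext_floorE b :
  ext_floor (lincomb b) = lincomb (fun i j => padic_floor p vF (b i j)).
Proof.
rewrite /ext_floor; set P := [set c | _].
have [|b' bb' ->] := @xgetPex _ 0 P; first by eexists; exists b.
congr lincomb; apply/funext => i; apply/funext => j; apply: padic_floor_eq => //.
have := lincomb_coef_le (fun i j => b' i j - b i j) i j.
rewrite -lincombB bb' subrr absv0 pmulr_lle0 ?exprn_gt0// => /le_lt_trans; exact.
Qed.

Lemma ext_floor_lt1 x : vK (x - ext_floor x) < 1.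
Proof.
have [b ->] := lincomb_surj x; rewrite ext_floorE lincombB.
by apply: lincomb_absv_lt1 => i j; have [] := padic_floorP p_prime F_padic (b i j).
Qed.

Lemma ext_floor_eq x y : vK (x - y) < 1 -> ext_floor x = ext_floor y.
Proof.
have [b ->] := lincomb_surj x; have [c ->] := lincomb_surj y.
rewrite !ext_floorE lincombB => bc; congr lincomb.
apply/funext => i; apply/funext => j; apply: padic_floor_eq => //.
apply: le_lt_trans bc; apply: le_trans (lincomb_coef_le _ i j).
by rewrite ler_peMr ?absv_ge0// exprn_ege1// ltW.
Qed.

(** The coefficients of a floor have the form [N / p ^ k]. Countability allows the branches of the
    map to be indexed by [nat]. *)
Lemma countable_ext_floor : countable (range ext_floor).
Proof.
pose g (h : {ffun 'I_e * 'I_f -> nat * nat}) : K :=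
  lincomb (fun i j => (h (i, j)).1%:R / p%:R ^+ (h (i, j)).2).
apply: (@sub_countable _ _ _ (range g)); last first.
  exact: sub_countable (card_image_le _ _) (countableP _).
apply: subset_card_le => _ [x _ <-]; have [b ->] := lincomb_surj x.
have : forall ij : 'I_e * 'I_f, exists Nk : nat * nat,
    padic_floor p vF (b ij.1 ij.2) = Nk.1%:R / p%:R ^+ Nk.2.
  move=> [i j]; have [_ [N [k [_ bE]]]] := padic_floorP p_prime F_padic (b i j).
  by exists (N, k).
move=> /boolp.choice[h hP]; exists [ffun ij => h ij] => //.
rewrite ext_floorE; congr lincomb; apply/funext => i; apply/funext => j.
by rewrite ffunE -(hP (i, j)).
Qed.

End Floor.

End Extension.

(** * Full-branch maps with independent branches *)

Section FullBranchMap.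
Local Open Scope ereal_scope.
Variables (d : measure_display) (X : measurableType d) (R : realType).
Variables (nu : {measure set X -> \bar R}) (T : X -> X) (D : nat -> set X).
Hypothesis nu1 : nu [set: X] = 1.
Hypothesis measurable_map : measurable_fun [set: X] T.
Hypothesis measurable_branch : forall i, measurable (D i).
Hypothesis trivIset_branch : trivIset [set: nat] D.
Hypothesis branch_full : nu (~` \bigcup_i D i) = 0.
Hypothesis branch_indep : forall i E, measurable E ->
  nu (D i `&` T @^-1` E) = nu (D i) * nu E.

Lemma measurable_preimage E : measurable E -> measurable (T @^-1` E).
Proof. by move=> mE; rewrite -[_ @^-1` _]setTI; exact: measurable_map. Qed.

Lemma measurable_iter_preimage n E : measurable E -> measurable (iter n T @^-1` E).
Proof.
move=> mE; elim: n => [//|n IH].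
have -> : iter n.+1 T @^-1` E = T @^-1` (iter n T @^-1` E).
  by apply/seteqP; split => x; rewrite /preimage /= -iterSr.
exact: measurable_preimage.
Qed.

Lemma finite_nu E : measurable E -> nu E \is a fin_num.
Proof.
move=> mE; rewrite ge0_fin_numE ?measure_ge0// (@le_lt_trans _ _ 1) ?ltry//.
by rewrite -nu1 le_measure ?inE//; exact: measurableT.
Qed.

Lemma conull_setI E N : measurable E -> measurable N -> nu (~` N) = 0 ->
  nu (E `&` N) = nu E.
Proof.
move=> mE mN N0; rewrite [RHS](measureDI nu mE mN).
rewrite -[LHS]add0e; congr (_ + _); apply/esym/eqP.
rewrite eq_le measure_ge0 andbT -N0 le_measure ?inE//.
  exact: measurableD.
exact: measurableC.
Qed.

Lemma nu_branch_series E : measurable E -> nu E = \sum_(i <oo) nu (D i `&` E).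
Proof.
move=> mE; rewrite -(conull_setI mE _ branch_full); last exact: bigcupT_measurable.
have mED i : measurable (E `&` D i) by exact: measurableI.
rewrite setI_bigcupr measure_semi_bigcup//.
- by apply: eq_eseriesr => i _; rewrite setIC.
- exact: trivIset_setIl.
- exact: bigcupT_measurable.
Qed.

(** Summing [branch_indep] over the branches, the factors [nu (D i)] add up to 1. *)
Lemma branch_map_preserving E : measurable E -> nu (T @^-1` E) = nu E.
Proof.
move=> mE; rewrite nu_branch_series; last exact: measurable_preimage.
under eq_eseriesr => i _ do rewrite branch_indep// muleC -(fineK (finite_nu mE)).
rewrite nneseriesZl ?fineK ?finite_nu//.
rewrite (_ : \sum_(i <oo) _ = 1) ?mule1//.
rewrite -nu1 nu_branch_series; last exact: measurableT.
by apply: eq_eseriesr => i _; rewrite setIT.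
Qed.

Lemma branch_iter_preserving n E : measurable E -> nu (iter n T @^-1` E) = nu E.
Proof.
move=> mE; elim: n => [//|n IH].
have -> : iter n.+1 T @^-1` E = T @^-1` (iter n T @^-1` E).
  by apply/seteqP; split => x; rewrite /preimage /= -iterSr.
by rewrite branch_map_preserving//; exact: measurable_iter_preimage.
Qed.

(** The points that have digits of every rank. *)
Definition regular_points : set X :=
  \bigcap_n (iter n T @^-1` \bigcup_i D i).

Lemma measurable_regular_points : measurable regular_points.
Proof.
apply: bigcapT_measurable => n; apply: measurable_iter_preimage.
exact: bigcupT_measurable.
Qed.

Lemma regular_points_full : nu (~` regular_points) = 0.
Proof.
have mDT : measurable (\bigcup_i D i) by exact: bigcupT_measurable.
apply: measure_negligible; first exact/measurableC/measurable_regular_points.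
rewrite setC_bigcap; apply: negligible_bigcup => n.
apply/negligibleP; first by apply/measurableC/measurable_iter_preimage.
exact: etrans (branch_iter_preserving n (measurableC mDT)) branch_full.
Qed.

(** Stands for an event in the first [n] digits; recording its independence from the later digits
    avoids any coding of words. *)
Definition branch_independent n E := measurable E /\
  forall A, measurable A -> nu (iter n T @^-1` A `&` E) = nu A * nu E.

Lemma branch_independentS n (E : nat -> set X) :
  (forall i, branch_independent n (E i)) ->
  branch_independent n.+1 (\bigcup_i (D i `&` T @^-1` E i)).
Proof.
move=> indE; have mE i : measurable (T @^-1` E i).
  by apply: measurable_preimage; have [] := indE i.
have mDE i : measurable (D i `&` T @^-1` E i) by exact: measurableI.
have tDE : trivIset [set: nat] (fun i => D i `&` T @^-1` E i).
  exact: trivIset_setIr.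
split=> [|A mA]; first exact: bigcupT_measurable.
have mTA k := measurable_iter_preimage k mA.
have mTADE i : measurable (iter n.+1 T @^-1` A `&` (D i `&` T @^-1` E i)).
  exact: measurableI.
rewrite setI_bigcupr !measure_semi_bigcup//; last 3 first.
- exact: bigcupT_measurable.
- exact: trivIset_setIl.
- exact: bigcupT_measurable.
rewrite -(fineK (finite_nu mA)) -nneseriesZl//; apply: eq_eseriesr => i _.
rewrite fineK ?finite_nu// setICA.
have [mEi indEi] := indE i.
have -> : iter n.+1 T @^-1` A `&` T @^-1` E i = T @^-1` (iter n T @^-1` A `&` E i).
  by apply/seteqP; split => x; rewrite /preimage /= -iterSr.
rewrite !branch_indep//; last exact: measurableI.
by rewrite indEi// muleCA.
Qed.

(* A tail set [A = T^-n A_n] is independent of every set in [branch_independent n],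
   so of everything that such sets approximate, and finally of itself. *)
Lemma tail_zero_one (G : set (set X)) (W : set X -> nat -> set X) A :
    d.-measurable = <<s G >> -> setI_closed G -> G [set: X] ->
    (forall U n, G U -> branch_independent n (W U n)) ->
    (forall U n, G U -> W U n `<=` W U n.+1) ->
    (forall U, G U -> \bigcup_n W U n = U `&` regular_points) ->
    (\bigcap_n preimage_set_system [set: X] (iter n T) measurable) A ->
  nu A = 0 \/ nu A = 1.
Proof.
move=> GE GI GT Wind Wmon WU tailA.
have mG U : G U -> measurable U.
  by move=> GU; rewrite GE; exact: sub_sigma_algebra.
have mA : measurable A by have [B mB <-] := tailA 0%N I; rewrite setTI.
have fA := finite_nu mA.
have indU U : G U -> nu (A `&` U) = nu A * nu U.
  move=> GU; have mU := mG U GU; have mX0 := measurable_regular_points.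
  have X0 := regular_points_full.
  have mW n : measurable (W U n) by have [] := Wind U n GU.
  have monW : {homo W U : n m / (n <= m)%N >-> (n <= m)%O}.
    by apply/nondecreasing_seqP => n; apply/subsetPset; exact: Wmon.
  rewrite -(conull_setI mU mX0 X0) -(conull_setI (measurableI _ _ mA mU) mX0 X0).
  rewrite -setIA -WU//.
  have mUW : measurable (\bigcup_n W U n) by exact: bigcupT_measurable.
  have cW := nondecreasing_cvg_mu (mu := nu) mW mUW monW.
  have cAW : (nu \o (fun n => A `&` W U n)) x @[x --> \oo] --> nu (A `&` \bigcup_n W U n).
    rewrite setI_bigcupr; apply: nondecreasing_cvg_mu.
    - by move=> n; exact: measurableI.
    - by rewrite -setI_bigcupr; exact: measurableI.
    - by move=> n m /monW nm; apply/subsetPset; apply: setIS; exact/subsetPset.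
  apply: (cvg_unique _ cAW) => //.
  rewrite (_ : nu \o _ = fun n => nu A * nu (W U n));
    first by move=> /=; exact: (cvgeZl fA cW).
  (* A tail event is the preimage of some [B] under [iter n T], and [nu B = nu A] by invariance. *)
  apply/funext => n /=; have [_ indW] := Wind U n GU.
  have [B mB AE] := tailA n I; rewrite setTI in AE.
  by rewrite -AE indW// branch_iter_preserving.
(* Independence passes from [G] to the sigma-algebra it generates by uniqueness of finite measures;
   the result is then read at [A] itself. *)
have nuA_ge0 : (0 <= fine (nu A))%R by rewrite fine_ge0.
pose m1 : {measure set X -> \bar R} := mrestr nu mA.
pose m2 : {measure set X -> \bar R} := mscale (NngNum nuA_ge0) nu.
have m12 : m1 A = m2 A.
  apply: (measure_unique G (fun=> [set: X])) => //.
  - by rewrite bigcup_const.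
  - move=> U GU; change (nu (U `&` A) = (fine (nu A))%:E * nu U).
    by rewrite setIC indU// fineK.
  - move=> _; change (nu ([set: X] `&` A) < +oo).
    by rewrite setTI -ge0_fin_numE.
have {m12} : nu (A `&` A) = (fine (nu A))%:E * nu A := m12.
have : nu A = (fine (nu A))%:E by rewrite fineK.
rewrite setIid; move: (fine _) => a ->; rewrite -EFinM => -[] a_idem.
have /eqP : (a * (a - 1) = 0)%R by rewrite mulrBr mulr1 -a_idem subrr.
by rewrite mulf_eq0 subr_eq0 => /orP[] /eqP ->; [left|right].
Qed.

End FullBranchMap.

(** * The continued fraction map on the unit ball *)

Section UnitBall.
Variables (R : realType) (K : fieldType) (v : absval R K).
Hypothesis vU : ultrametric v.

(** Reads a point of the ball in the field [K] rather than in its metric alias, so that field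
    operations apply. *)
Definition ball_val (x : unit_ball_type v) : K := \val x.

Lemma ball_val_lt1 x : v (ball_val x) < 1.
Proof. by have := valP x; rewrite inE. Qed.

Lemma ball_val_inj : injective ball_val.
Proof. exact: val_inj. Qed.

Lemma ball_valK (y : K) : v y < 1 ->
  ball_val (insubd (point : unit_ball_type v) (y : vspace v)) = y.
Proof. by move=> y1; apply: insubdK; rewrite inE. Qed.

Lemma open_unit_ball_typeP (U : set (unit_ball_type v)) :
  open U <-> forall x, U x ->
    exists2 r : R, 0 < r & forall y, v (ball_val x - ball_val y) < r -> U y.
Proof.
split=> [[W /open_vspaceP oW <-] x Wx|U_open].
  by have [r r0 rW] := oW _ Wx; exists r => // y xy; exact: rW.
pose W : set (vspace v) := [set y : K | exists2 r : R, 0 < r &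
  forall z, v (y - ball_val z) < r -> U z].
exists W.
  apply/open_vspaceP => x [r r0 rU]; exists r => // y xy.
  by exists r => // z yz; apply: rU; exact: (absv_distl_lt vU xy).
apply/seteqP; split=> [x [r r0 rU]|x Ux].
  by apply: rU; rewrite subrr absv0.
by have [r r0 rU] := U_open _ Ux; exists r.
Qed.

End UnitBall.

(** * Discs and their measure *)

Section Discs.
Variables (R : realType) (K : fieldType) (v : absval R K) (b : K).
Variables (q : nat) (rep : 'I_q -> K).
Variable mu : {measure set (borel (vspace v)) -> \bar R}.
Hypothesis vU : ultrametric v.
Hypothesis b_gt1 : 1 < v b.
Hypothesis b_value : forall y, y != 0 -> exists z : int, v y = v b ^ z.
Hypothesis rep_exist : forall y, v y <= 1 -> exists i, v (y - rep i) < 1.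
Hypothesis rep_inj : forall i j, v (rep i - rep j) < 1 -> i = j.
Hypothesis rep_le1 : forall i, v (rep i) <= 1.
Hypothesis mu_trans : forall (a : K) (A : set K),
  measurable (A : set (borel (vspace v))) -> mu [set a + x | x in A] = mu A.
Hypothesis mu_ball : mu (unit_ball v) = 1%E.

Let b_gt0 : 0 < v b. Proof. exact: lt_trans b_gt1. Qed.
Let bX_gt0 n : 0 < v b ^- n. Proof. by rewrite invr_gt0 exprn_gt0. Qed.
Let bX_le1 n : v b ^- n <= 1.
Proof. by rewrite invf_le1 ?exprn_gt0// exprn_ege1// ltW. Qed.
Let bV01 : 0 <= (v b)^-1 < 1.
Proof. by rewrite invr_ge0 (ltW b_gt0) invf_lt1. Qed.
Let b_neq0 : b != 0. Proof. by rewrite -(absv_gt0 v). Qed.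

(** As [v b] generates the value group, an open disc is also the closed disc of the next smaller
    radius. *)
Lemma absv_ltV_le y n : (v y < v b ^- n) = (v y <= v b ^- n.+1).
Proof.
have [->|/b_value[z ->]] := eqVneq y 0; first by rewrite absv0 bX_gt0 ltW.
by rewrite !exprnN ltr_eXz2l// ler_eXz2l// -[n.+1]addn1 PoszD opprD lerBrDr lezD1.
Qed.

Definition disc (a : K) n : set K := [set x | v (x - a) < v b ^- n].

Lemma measurable_disc a n : measurable (disc a n : set (borel (vspace v))).
Proof.
apply: sub_sigma_algebra; apply/open_vspaceP => x ax.
exists (v b ^- n) => // y xy; rewrite /disc /=.
by apply: (absv_distl_lt vU _ ax); rewrite absvB.
Qed.

Lemma mu_disc_trans a n : mu (disc a n) = mu (disc 0 n).
Proof.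
rewrite -[RHS](mu_trans a); last exact: measurable_disc.
congr (mu _); apply/seteqP; split=> [x ax|_ [x x0 <-]].
  by exists (x - a); rewrite /disc /= ?subr0// addrC subrK.
by rewrite /disc /= addrC addKr; move: x0; rewrite /disc /= subr0.
Qed.

Lemma residue_size_gt1 : (1 < q)%N.
Proof.
have [i i0] := @rep_exist 0 (eq_ind_r (fun t => t <= 1) ler01 (absv0 v)).
have [j j1] := @rep_exist 1 (eq_ind_r (fun t => t <= 1) (lexx 1) (absv1 v)).
rewrite ltnNge; apply/negP => q1.
have k0 (k : 'I_q) : k = 0%N :> nat.
  by apply/eqP; rewrite -leqn0 -ltnS (leq_trans (ltn_ord k)).
have ij : i = j by apply/val_inj; rewrite /= !k0.
have : v (1 : K) < 1.
  by rewrite -[1]subr0; apply: (absv_distl_lt vU j1); rewrite absvB -ij.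
by rewrite absv1 ltxx.
Qed.

(** Multiplication by [b ^+ n.+1] turns [disc 0 n] into the closed unit ball, whose [q] residue
    classes pull back to translates of [disc 0 n.+1]. *)
Lemma mu_disc a n : mu (disc a n) = (q%:R ^- n)%:E.
Proof.
have q0 : q%:R != 0 :> R by rewrite pnatr_eq0 -lt0n (ltn_trans _ residue_size_gt1).
rewrite mu_disc_trans; elim: n => [|n IH].
  rewrite expr0 invr1 -mu_ball; congr (mu _).
  by apply/seteqP; split => x; rewrite /disc /unit_ball /= subr0 expr0 invr1.
pose c i : K := rep i / b ^+ n.+1.
have discE : disc 0 n = \big[setU/set0]_(i < q) disc (c i) n.+1.
  rewrite -bigcup_seq; apply/seteqP; split=> [x|x [i _]]; rewrite /disc /= ?subr0.
    rewrite absv_ltV_le => xn.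
    have [|i xi] := @rep_exist (x * b ^+ n.+1).
      by rewrite absvM absvX -ler_pdivlMr ?exprn_gt0// mul1r.
    exists i; rewrite /= ?mem_index_enum//.
    rewrite (_ : x - c i = (x * b ^+ n.+1 - rep i) / b ^+ n.+1); last first.
      by rewrite mulrBl mulfK ?expf_neq0.
    by rewrite absvM absvV absvX ltr_pdivrMr ?exprn_gt0// mulVf ?expf_neq0// ?gt_eqF.
  move=> xi; rewrite absv_ltV_le -[x](subrK (c i)) (absvD_le vU) ?(ltW xi)//.
  by rewrite absvM absvV absvX ler_piMl// ltW.
have : mu (disc 0 n) = (\sum_(i < q) mu (disc (c i) n.+1))%E.
  rewrite discE; apply: measure_semi_additive_ord.
  - by move=> i; exact: measurable_disc.
  - apply/trivIsetP => i j _ _ /eqP ij; rewrite -subset0 => x [xi xj]; apply: ij.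
    apply: rep_inj; rewrite -[X in v X](@mulfK _ (b ^+ n.+1)) ?expf_neq0//.
    rewrite mulrAC absvM absvX -ltr_pdivlMr ?exprn_gt0// mul1r mulrBl.
    by apply: (absv_distl_lt vU _ xj); rewrite absvB.
  - by rewrite -discE; exact: measurable_disc.
under eq_bigr => i _ do rewrite mu_disc_trans.
have fin : mu (disc 0 n.+1) \is a fin_num.
  rewrite ge0_fin_numE ?measure_ge0// (@le_lt_trans _ _ (mu (disc 0 n)))//; last first.
    by rewrite IH ltry.
  rewrite le_measure ?inE//; [exact: measurable_disc|exact: measurable_disc|].
  by move=> x; rewrite /disc /= subr0 => /ltW; rewrite absv_ltV_le.
rewrite IH -(fineK fin) sumEFin sumr_const card_ord => -[] h; congr EFin.
by apply: (mulfI q0); rewrite exprS invfM mulrA divff// mul1r h mulr_natl.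
Qed.

Definition ball_disc (a : K) n : set (unit_ball_type v) :=
  [set x | disc a n (ball_val x)].

Local Notation X := (borel (unit_ball_type v)).
Local Notation nu := (unit_ball_measure mu : {measure set X -> \bar R}).

Lemma ball_disc_measure a n : v a < 1 -> nu (ball_disc a n) = (q%:R ^- n)%:E.
Proof.
move=> a1; rewrite -(mu_disc a); congr (mu _); apply/seteqP; split=> [_ [x xa <-]//|y ya].
have y1 : v y < 1.
  rewrite -[y](subrK a) absvD_lt// (lt_le_trans ya)//.
exists (insubd (point : unit_ball_type v) (y : vspace v));
  rewrite /ball_disc /= ?[ball_val _]ball_valK//;
  exact: ball_valK.
Qed.

Lemma open_ball_disc a n : open (ball_disc a n).
Proof.
apply/(open_unit_ball_typeP vU) => x ax; exists (v b ^- n) => // y xy.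
by rewrite /ball_disc /disc /=; apply: (absv_distl_lt vU _ ax); rewrite absvB.
Qed.

Lemma ball_disc_center a c n : v (a - c) < v b ^- n -> ball_disc a n = ball_disc c n.
Proof.
move=> ac; apply/seteqP; split=> x xa; rewrite /ball_disc /disc /=.
  exact: (absv_distl_lt vU xa).
by apply: (absv_distl_lt vU xa); rewrite absvB.
Qed.

Lemma subset_ball_disc a m n : (m <= n)%N -> ball_disc a n `<=` ball_disc a m.
Proof.
move=> mn x; rewrite /ball_disc /disc /= => /lt_le_trans; apply.
by rewrite lef_pV2 ?posrE ?exprn_gt0// ler_eXn2l.
Qed.

(** The empty set makes the family closed under intersection, as two discs may be disjoint. *)
Definition discs : set (set (unit_ball_type v)) :=
  [set E | E = set0 \/ exists a n, v a < 1 /\ E = ball_disc a n].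

Lemma discs_setI_closed : setI_closed discs.
Proof.
move=> E F [->|[a [m [a1 ->]]]]; first by rewrite set0I; left.
move=> [->|[c [n [c1 ->]]]]; first by rewrite setI0; left.
wlog mn : a c m n a1 c1 / (m <= n)%N.
  move=> H; have [|/ltnW] := leqP m n; first exact: H.
  by rewrite setIC; exact: H.
have [ac|ac] := ltP (v (a - c)) (v b ^- m).
  right; exists c, n; split=> //; rewrite (ball_disc_center ac).
  by apply/setIidr; exact: subset_ball_disc.
left; rewrite -subset0 => x [xa /(subset_ball_disc mn) xc].
suff : v (a - c) < v b ^- m by rewrite ltNge ac.
by apply: (absv_distl_lt vU _ xc); rewrite absvB.
Qed.

Variables (fl : K -> K) (code : K -> nat) (decode : nat -> K).
Hypothesis fl_lt1 : forall x, v (x - fl x) < 1.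
Hypothesis decode_fl : forall x, decode (code (fl x)) = fl x.

(** The floors supply countably many centres: [fl (y * b ^+ N) / b ^+ N] lies within [v b ^- N] of
    [y]. Every open set is thus a countable union of discs. *)
Lemma measurable_discs :
  (@measurable _ (borel (unit_ball_type v))) = <<s discs >>.
Proof.
apply/seteqP; split; last first.
  apply: smallest_sub; first exact: sigma_algebra_measurable.
  move=> E [->|[a [n [_ ->]]]]; first exact: measurable0.
  by apply: sub_sigma_algebra; exact: open_ball_disc.
apply: smallest_sub; first exact: smallest_sigma_algebra.
move=> U oU; pose c n i := decode i / b ^+ n.
pose F n i :=
  [set x | [/\ v (c n i) < 1, ball_disc (c n i) n `<=` U & ball_disc (c n i) n x]].
have -> : U = \bigcup_n \bigcup_i F n i.
  apply/seteqP; split=> [x Ux|x [n _ [i _ [_ FU]]]]; last exact: FU.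
  have /(open_unit_ball_typeP vU) := oU; move=> /(_ x Ux)[r r0 rU].
  have [N hN] := geometric_lt ler01 bV01 r0.
  have {}hN : v b ^- N < r by rewrite -exprVn -[ltLHS]mul1r; exact: hN.
  pose y := ball_val x; pose i := code (fl (y * b ^+ N)).
  have yc : v (y - c N i) < v b ^- N.
    rewrite (_ : y - c N i = (y * b ^+ N - fl (y * b ^+ N)) / b ^+ N); last first.
      by rewrite /c decode_fl mulrBl mulfK ?expf_neq0.
    by rewrite absvM absvV absvX -[ltRHS]mul1r ltr_pM2r.
  exists N => //; exists i => //; split=> [|z zc|//].
    rewrite -[c N i](subKr y); apply: (absvB_lt vU (ball_val_lt1 x)).
    exact: lt_le_trans yc (bX_le1 _).
  apply: rU; apply: lt_trans hN; apply: (absv_distl_lt vU yc).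
  by rewrite absvB.
apply: sigma_algebra_bigcup => n; apply: sigma_algebra_bigcup => i.
have [c1|c1] := boolp.pselect (v (c n i) < 1 /\ ball_disc (c n i) n `<=` U).
  rewrite (_ : F n i = ball_disc (c n i) n).
    by apply: sub_sigma_algebra; right; exists (c n i), n; split => //; case: c1.
  by apply/seteqP; split=> [x []//|x xc]; case: c1.
rewrite (_ : F n i = set0); first exact: sigma_algebra0.
by rewrite -subset0 => x [? ? _]; apply: c1.
Qed.

(** * Branches of the continued fraction map *)

Hypothesis fl_eq : forall x y, v (x - y) < 1 -> fl x = fl y.
Variable T : unit_ball_type v -> unit_ball_type v.
Hypothesis ball_val_map : forall x, ball_val x != 0 ->
  ball_val (T x) = (ball_val x)^-1 - fl (ball_val x)^-1.

Definition branch i : set (unit_ball_type v) :=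
  [set x | ball_val x != 0 /\ code (fl (ball_val x)^-1) = i].

Lemma trivIset_branch : trivIset [set: nat] branch.
Proof.
by apply/trivIsetP => i j _ _ ij; rewrite -subset0 => x [[_ xi] [_ xj]];
  move: ij; rewrite -xi -xj eqxx.
Qed.

Lemma bigcup_branchE x : (\bigcup_i branch i) x <-> ball_val x != 0.
Proof.
by split=> [[i _ []]//|x0]; exists (code (fl (ball_val x)^-1)).
Qed.

(** [d] differs from [1/x] by less than 1 while [1/x] has value above 1, so they share value and
    floor; [k.+1] records that the value of [d] exceeds 1. *)
Lemma branch_digit (x : unit_ball_type v) (d := fl (ball_val x)^-1) :
    ball_val x != 0 ->
  [/\ v d = (v (ball_val x))^-1, fl d = d & exists k, v d = v b ^+ k.+1].
Proof.
move=> x0; have vx0 : 0 < v (ball_val x) by rewrite absv_gt0.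
have xV1 : 1 < v (ball_val x)^-1 by rewrite absvV invf_gt1// ball_val_lt1.
have dx : v (d - (ball_val x)^-1) < 1 by rewrite absvB fl_lt1.
have vd : v d = (v (ball_val x))^-1.
  by rewrite -absvV; apply: (absv_near vU); exact: lt_trans xV1.
split=> //; first exact: fl_eq.
have d0 : d != 0 by rewrite -(absv_gt0 v) vd invr_gt0.
have [z vz] := b_value d0; move: xV1; rewrite absvV -vd vz -(expr0z (v b)).
rewrite ltr_eXz2l//; case: z vz => [[|k]|k] vz //= _.
by exists k.
Qed.

(** On points of value [1/|d|], inversion divides distances by [|d|^2 = v b ^+ k.+1.*2]; undoing the
    subtraction of [d] moves the centre [a] to [d + a] before inverting. *)
Lemma branch_discE (x : unit_ball_type v) d k a n :
    ball_val x != 0 -> fl (ball_val x)^-1 = d -> v d = v b ^+ k.+1 -> v a < 1 ->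
  branch (code d) `&` T @^-1` ball_disc a n = ball_disc (d + a)^-1 (n + k.+1.*2).
Proof.
move=> x0 xd vd a1; have [_ fld _] := branch_digit x0; rewrite xd in fld.
have d_gt1 : 1 < v d by rewrite vd exprn_egt1.
have d0 : v d != 0 by rewrite gt_eqF// (lt_trans _ d_gt1).
pose w := d + a.
have vw : v w = v d.
  by apply: (absv_near vU); rewrite /w addrAC subrr add0r (lt_trans a1).
have w0 : w != 0 by rewrite -(absv_eq0 v) vw.
have radE : v b ^- (n + k.+1.*2) = v b ^- n / v d ^+ 2.
  by rewrite vd exprD invfM -exprM -muln2.
(* From [y - 1/w = - (1/y - w) * y / w], where [y] and [1/w] both have value [1/|d|]. *)
have dist_inv y : v y = (v d)^-1 -> v (y - w^-1) = v (y^-1 - w) / v d ^+ 2.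
  move=> vy; have y0 : y != 0 by rewrite -(absv_eq0 v) vy invr_eq0.
  rewrite (_ : y - w^-1 = - ((y^-1 - w) * y / w)); last by field; rewrite y0 w0.
  by rewrite absvN !absvM absvV vy vw expr2 invfM mulrA.
have lt_rad r : (r < v b ^- n) = (r / v d ^+ 2 < v b ^- (n + k.+1.*2)).
  by rewrite radE ltr_pM2r// invr_gt0 exprn_gt0// (lt_trans _ d_gt1).
apply/seteqP; split=> y; rewrite /ball_disc /disc /=.
  move=> [[y0 yd]]; rewrite /preimage /= ball_val_map// -(decode_fl (ball_val y)^-1) yd.
  rewrite -xd decode_fl xd -addrA -opprD -/w => yw.
  rewrite dist_inv -?lt_rad//; apply: invr_inj; rewrite invrK -absvV -vw.
  apply: (absv_near vU); rewrite (lt_trans (lt_le_trans yw (bX_le1 _)))//.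
  by rewrite vw.
move=> yw; have vy : v (ball_val y) = (v d)^-1.
  rewrite -vw -absvV; apply: (absv_near vU); rewrite (lt_trans yw)// absvV vw radE.
  rewrite expr2 invfM mulrA gtr_pMl ?invr_gt0 ?(lt_trans _ d_gt1)//.
  rewrite (le_lt_trans (ler_piMl _ (bX_le1 _))) ?invr_ge0 ?absv_ge0// invf_lt1//.
  exact: lt_trans d_gt1.
have y0 : ball_val y != 0 by rewrite -(absv_eq0 v) vy invr_eq0.
move: yw; rewrite dist_inv// -lt_rad => yw.
have yd : fl (ball_val y)^-1 = d.
  rewrite -fld; apply: fl_eq; rewrite -(subrKA w) absvD_lt//.
    exact: lt_le_trans yw (bX_le1 _).
  by rewrite /w addrAC subrr add0r.
split; first by split=> //; rewrite yd.
by rewrite /preimage /= ball_val_map// yd -addrA -opprD.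
Qed.

Implicit Types x t : unit_ball_type v.

Lemma measurable_zero : measurable ([set x | ball_val x = 0] : set X).
Proof.
rewrite -[X in measurable X]setCK; apply: measurableC; apply: sub_sigma_algebra.
apply/(open_unit_ball_typeP vU) => x /eqP x0.
exists (v (ball_val x)); first by rewrite absv_gt0.
by move=> y xy y0; move: xy; rewrite y0 subr0 ltxx.
Qed.

(** [T] is continuous away from 0, so the preimage of an open set is open up to that single
    point. *)
Lemma measurable_cf : measurable_fun [set: X] (T : X -> X).
Proof.
apply: (@measurability _ _ X X setT T (@open (unit_ball_type v)) erefl).
move=> _ [U /(open_unit_ball_typeP vU) oU <-].
pose Z : set X := [set x | ball_val x = 0].
rewrite -(setUv Z) setIUl; apply: measurableU.
  have [[z [z0 Uz]]|noz] := boolp.pselect (exists z, Z z /\ U (T z)).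
    rewrite (_ : _ `&` _ = Z); first exact: measurable_zero.
    apply/setIidl => x x0; rewrite /preimage /=.
    by rewrite (_ : x = z)//; apply: ball_val_inj; rewrite x0 z0.
  rewrite (_ : _ `&` _ = set0); first exact: measurable0.
  by rewrite -subset0 => x [x0 Ux]; apply: noz; exists x.
apply: sub_sigma_algebra; apply/(open_unit_ball_typeP vU) => x [/eqP x0 UTx].
have [r r0 rU] := oU _ UTx.
have vx0 : 0 < v (ball_val x) by rewrite absv_gt0.
pose s := Num.min 1 r; have s0 : 0 < s by rewrite lt_min ltr01.
(* The first bound forces [|y| = |x|]; the second then brings [1/y] within [min 1 r] of [1/x], where
   1 preserves the floor and [r] keeps [T y] in [U]. *)
exists (Num.min (v (ball_val x)) (s * v (ball_val x) ^+ 2)) => [|y].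
  by rewrite lt_min vx0 mulr_gt0// exprn_gt0.
rewrite lt_min absvB => /andP[xy1 xy2].
have vy : v (ball_val y) = v (ball_val x) by exact: (absv_near vU).
have y0 : ball_val y != 0 by rewrite -(absv_gt0 v) vy.
have dist : v ((ball_val x)^-1 - (ball_val y)^-1) < s.
  rewrite (_ : _ - _ = (ball_val y - ball_val x) / (ball_val x * ball_val y)).
    by rewrite absvM absvV absvM vy -expr2 ltr_pdivrMr// exprn_gt0.
  by field; rewrite x0 y0.
move: dist; rewrite lt_min => /andP[dist1 dist2].
split; first exact/eqP.
by apply: rU; rewrite !ball_val_map// (fl_eq dist1) opprB addrA subrK.
Qed.

Lemma branch_cases i : branch i = set0 \/ exists x d k,
  [/\ ball_val x != 0, fl (ball_val x)^-1 = d, v d = v b ^+ k.+1 & i = code d].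
Proof.
have [[x [x0 xi]]|none] := boolp.pselect (branch i !=set0); [right|left].
  by have [_ _ [k vd]] := branch_digit x0; exists x, (fl (ball_val x)^-1), k; split.
by rewrite -subset0 => x xi; apply: none; exists x.
Qed.

Lemma branchE x d k :
    ball_val x != 0 -> fl (ball_val x)^-1 = d -> v d = v b ^+ k.+1 ->
  branch (code d) = ball_disc d^-1 k.+1.*2.
Proof.
move=> x0 xd vd; have := @branch_discE x d k 0 0 x0 xd vd.
rewrite absv0 addr0 => /(_ ltr01) <-; apply/esym/setIidl => y _.
by rewrite /preimage /= /ball_disc /disc /= subr0 expr0 invr1 ball_val_lt1.
Qed.

Lemma measurable_branch i : measurable (branch i : set X).
Proof.
have [->|[x [d [k [x0 xd vd ->]]]]] := branch_cases i; first exact: measurable0.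
by rewrite (branchE x0 xd vd); apply: sub_sigma_algebra; exact: open_ball_disc.
Qed.

Lemma nu_setT : nu [set: X] = 1%E.
Proof.
rewrite -mu_ball; congr (mu _); apply/seteqP; split=> [_ [x _ <-]|x x1].
  exact: ball_val_lt1.
by exists (insubd (point : unit_ball_type v) x) => //; exact: ball_valK.
Qed.

(** The complement is the point 0, which lies in discs of arbitrarily small mass. *)
Lemma nu_zero : nu (~` \bigcup_i branch i) = 0%E.
Proof.
pose Z : set X := [set x | ball_val x = 0].
have mZ : measurable Z := measurable_zero.
have -> : ~` (\bigcup_i branch i) = Z.
  apply/seteqP; split=> x; last by move=> x0 /bigcup_branchE; rewrite x0 eqxx.
  by move=> nx /=; apply/eqP; apply: contra_notT nx => /bigcup_branchE.
have le n : (nu Z <= (q%:R ^- n)%:E)%E.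
  rewrite -(@ball_disc_measure 0 n) ?absv0// le_measure ?inE//.
    by apply: sub_sigma_algebra; exact: open_ball_disc.
  by move=> x x0; rewrite /ball_disc /disc /= x0 subr0 absv0 bX_gt0.
have q1 : 0 <= (q%:R^-1 : R) < 1.
  by rewrite invr_ge0 ler0n invf_lt1 ?ltr0n ?ltr1n ?residue_size_gt1// ltnW// residue_size_gt1.
apply/eqP; rewrite eq_le measure_ge0 andbT; apply/lee_addgt0Pr => r r0; rewrite add0e.
have [N hN] := geometric_lt ler01 q1 r0.
by rewrite (le_trans (le N))// lee_fin ltW// -exprVn -[ltLHS]mul1r hN.
Qed.

(** Both sides are finite measures in [E]. On a disc, pulling back into the branch raises the
    exponent [n] by [k.+1.*2], which multiplies the mass by that of the branch. *)
Lemma nu_branch_indep i E : measurable (E : set X) ->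
  nu (branch i `&` T @^-1` E) = (nu (branch i) * nu E)%E.
Proof.
have [->|[x [d [k [x0 xd vd ->]]]]] := branch_cases i.
  by move=> _; rewrite set0I measure0 mul0e.
have mB : measurable (branch (code d) : set X) by exact: measurable_branch.
have d_gt1 : 1 < v d by rewrite vd exprn_egt1.
have ball1 (c : K) : v c < 1 -> v (d + c)^-1 < 1.
  move=> c1; have -> : v (d + c)^-1 = (v d)^-1.
    rewrite absvV; congr (_^-1); apply: (absv_near vU).
    by rewrite addrAC subrr add0r (lt_trans c1).
  by rewrite invf_lt1// (lt_trans _ d_gt1).
have d1 : v d^-1 < 1 by rewrite -[d]addr0 ball1 ?absv0.
have fB : nu (branch (code d)) = (q%:R ^- k.+1.*2)%:E.
  by rewrite (branchE x0 xd vd) ball_disc_measure.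
have q0 : 0 <= q%:R ^- k.+1.*2 :> R by rewrite invr_ge0 exprn_ge0.
unshelve epose (m1 := pushforward (mrestr nu mB) (T : X -> X) : {measure set X -> \bar R}).
  exact: measurable_cf.
pose m2 : {measure set X -> \bar R} := mscale (NngNum q0) nu.
move=> mE; rewrite setIC fB.
apply: (@measure_unique _ _ X discs (fun=> ball_disc 0 0) measurable_discs
  discs_setI_closed _ _ m1 m2) => //.
- by move=> _; right; exists 0, 0%N; rewrite absv0.
- rewrite bigcup_const//; apply/seteqP; split=> // y _.
  by rewrite /ball_disc /disc /= subr0 expr0 invr1 ball_val_lt1.
- move=> _ [->|[a [n [a1 ->]]]]; first by rewrite !measure0.
  change (nu (T @^-1` ball_disc a n `&` branch (code d)) =
    ((q%:R ^- k.+1.*2)%:E * nu (ball_disc a n))%E).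
  rewrite setIC (branch_discE _ x0 xd vd a1) !ball_disc_measure//; last exact: ball1.
  by rewrite -EFinM exprD invfM mulrC.
- move=> _; change (nu (T @^-1` ball_disc 0 0 `&` branch (code d)) < +oo)%E.
  by rewrite setIC (branch_discE _ x0 xd vd) ?absv0// ball_disc_measure ?ltry// ball1// absv0.
Qed.

(** * Regular points, inverse branches and cylinders *)

Local Notation regular := (@regular_points _ X T branch).

Lemma regularP x : regular x <-> forall n, ball_val (iter n T x) != 0.
Proof.
by split=> [h n|h n _]; [apply/bigcup_branchE; exact: h|apply/bigcup_branchE].
Qed.

Lemma regularE x : regular x <-> ball_val x != 0 /\ regular (T x).
Proof.
rewrite !regularP; split=> [h|[x0 h] [//|n]]; last by rewrite iterSr.
by split=> [|n]; [exact: (h 0%N)|rewrite -iterSr].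
Qed.

(** The default of [insubd] is not reached when [d] is the first digit of a nonzero point. *)
Definition inv_branch (d : K) (t : unit_ball_type v) : unit_ball_type v :=
  insubd (point : unit_ball_type v) ((d + ball_val t)^-1 : vspace v).

Section InverseBranch.
Variable x : unit_ball_type v.
Hypothesis x_neq0 : ball_val x != 0.
Let d := fl (ball_val x)^-1.

Lemma inv_branch_absv t : v (d + ball_val t) = (v (ball_val x))^-1.
Proof.
have [vd _ _] := branch_digit x_neq0; rewrite -vd; apply: (absv_near vU).
rewrite addrAC subrr add0r vd (lt_trans (ball_val_lt1 t))//.
by rewrite invf_gt1 ?ball_val_lt1// absv_gt0.
Qed.

Lemma ball_val_inv_branch t : ball_val (inv_branch d t) = (d + ball_val t)^-1.
Proof.
by apply: ball_valK; rewrite absvV inv_branch_absv invrK ball_val_lt1.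
Qed.

Lemma inv_branch_neq0 t : ball_val (inv_branch d t) != 0.
Proof.
rewrite ball_val_inv_branch invr_eq0 -(absv_eq0 v) inv_branch_absv.
by rewrite invr_eq0 absv_eq0.
Qed.

Lemma inv_branchK t : T (inv_branch d t) = t.
Proof.
have [_ fld _] := branch_digit x_neq0.
have fl_dt : fl (d + ball_val t) = d.
  by rewrite -[RHS]fld; apply: fl_eq; rewrite addrAC subrr add0r ball_val_lt1.
apply: ball_val_inj; rewrite ball_val_map ?inv_branch_neq0//.
by rewrite ball_val_inv_branch invrK fl_dt addrAC subrr add0r.
Qed.

Lemma map_inv_branch : inv_branch d (T x) = x.
Proof.
apply: ball_val_inj; rewrite ball_val_inv_branch ball_val_map//.
by rewrite addrC subrK invrK.
Qed.

Lemma inv_branch_contract (t t' : unit_ball_type v) n :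
    v (ball_val t - ball_val t') < v b ^- n ->
  v (ball_val (inv_branch d t) - ball_val (inv_branch d t')) < v b ^- n.+1.
Proof.
move=> tt'; have w0 (s : unit_ball_type v) : d + ball_val s != 0.
  by rewrite -(absv_eq0 v) inv_branch_absv invr_eq0 absv_eq0.
rewrite !ball_val_inv_branch.
rewrite (_ : _ - _ = - (ball_val t - ball_val t') / (d + ball_val t) / (d + ball_val t')).
  rewrite absv_ltV_le !absvM absvN !absvV !inv_branch_absv !invrK.
  have vx : v (ball_val x) <= v b ^- 1.
    by rewrite -absv_ltV_le expr0 invr1 ball_val_lt1.
  (* Each of the two denominators contributes a factor [v b ^- 1]; the exponent [n.+2] occurs
     because the strict bound at [n.+1] was restated as a weak one. *)
  have -> : v b ^- n.+2 = v b ^- n * v b ^- 1 * v b ^- 1.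
    by rewrite -!invfM -!exprD !addn1.
  by rewrite !ler_pM ?mulr_ge0 ?absv_ge0// ltW.
by field; rewrite !w0.
Qed.

End InverseBranch.

(* The union of the rank-[n] cylinders contained in [U], up to the null set of
   non-regular points. *)
Fixpoint cylinders n (U : set (unit_ball_type v)) : set (unit_ball_type v) :=
  if n is n'.+1 then
    [set x | ball_val x != 0 /\
       cylinders n' (inv_branch (fl (ball_val x)^-1) @^-1` U) (T x)]
  else [set x | regular x /\ regular `<=` U].

Lemma regular_inv_branch x t :
  ball_val x != 0 -> regular t -> regular (inv_branch (fl (ball_val x)^-1) t).
Proof. by move=> x0 t_reg; apply/regularE; rewrite inv_branch_neq0// inv_branchK. Qed.

Lemma cylinders_subS n U : cylinders n U `<=` cylinders n.+1 U.
Proof.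
elim: n U => [|n IH] U x.
  move=> [x_reg rU]; have [x0 Tx] := (regularE x).1 x_reg; split=> //; split=> // t t_reg.
  exact/rU/regular_inv_branch.
by move=> [x0 xU]; split=> //; exact: IH.
Qed.

Lemma cylinders_sub n U : cylinders n U `<=` U `&` regular.
Proof.
elim: n U => [|n IH] U x; first by move=> [x_reg rU]; split=> //; exact: rU.
move=> [x0 /IH[]]; rewrite /preimage /= map_inv_branch// => Ux Tx; split=> //.
exact/regularE.
Qed.

(** The rank-[n] cylinder of [x] has all its points within [v b ^- n] of [x], one contraction per
    inverse branch. *)
Lemma mem_cylinders n U x : regular x ->
  (forall y, v (ball_val x - ball_val y) < v b ^- n -> U y) -> cylinders n U x.
Proof.
elim: n U x => [|n IH] U x x_reg xU.
  split=> // y _; apply: xU; rewrite expr0 invr1.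
  by rewrite (absvB_lt vU) ?ball_val_lt1.
have [x0 Tx] := (regularE x).1 x_reg; split=> //; apply: IH => // t Tt.
apply: xU; rewrite -[X in ball_val X - _]map_inv_branch//.
exact: inv_branch_contract.
Qed.

Lemma bigcup_cylinders U : open U -> \bigcup_n cylinders n U = U `&` regular.
Proof.
move=> /(open_unit_ball_typeP vU) oU; apply/seteqP.
split=> [x [n _ /cylinders_sub//]|x [Ux x_reg]].
have [r r0 rU] := oU _ Ux; have [N hN] := geometric_lt ler01 bV01 r0.
exists N => //; apply: mem_cylinders => // y xy; apply: rU; apply: lt_trans xy _.
by rewrite -exprVn -[ltLHS]mul1r hN.
Qed.

(** At rank 0 the set is empty or has full measure. At the next rank it splits over the branches,
    each with its own pullback of [U], as in [branch_independentS]. *)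
Lemma cylinders_indep n U : @branch_independent _ X R nu T n (cylinders n U).
Proof.
have mreg : measurable (regular : set X).
  exact: (measurable_regular_points measurable_cf measurable_branch).
have reg_full := regular_points_full nu_setT measurable_cf measurable_branch
  trivIset_branch nu_zero nu_branch_indep.
elim: n U => [|n IH] U.
  have [rU|rU] := boolp.pselect (regular `<=` U); last first.
    rewrite (_ : cylinders 0 U = set0); last by rewrite -subset0 => x [].
    split=> [|A _]; first exact: measurable0.
    by rewrite setI0 measure0 mule0.
  rewrite (_ : cylinders 0 U = regular); last by apply/seteqP; split=> [x []|x].
  split=> // A mA; have nu_reg : nu regular = 1%E.
    rewrite -nu_setT -[regular]setTI.
    by apply: (conull_setI _ mreg reg_full); exact: measurableT.
  by rewrite nu_reg mule1; apply: (conull_setI mA mreg reg_full).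
have -> : cylinders n.+1 U =
    \bigcup_i (branch i `&` T @^-1` cylinders n (inv_branch (decode i) @^-1` U)).
  apply/seteqP; split=> [x [x0 xU]|x [i _ [[x0 <-]]]].
    exists (code (fl (ball_val x)^-1)) => //; split=> //.
    by rewrite /preimage /= decode_fl.
  by rewrite /preimage /= decode_fl => xU; split.
exact: (branch_independentS nu_setT measurable_cf measurable_branch
  trivIset_branch nu_branch_indep).
Qed.

Lemma unit_ball_map_exact : exact_system nu (T : X -> X).
Proof.
split.
- exact: nu_setT.
- exact: measurable_cf.
- exact: (branch_map_preserving nu_setT measurable_cf measurable_branch
    trivIset_branch nu_zero nu_branch_indep).
- move=> A; apply: (tail_zero_one nu_setT measurable_cf measurable_branch
    trivIset_branch nu_zero nu_branch_indep (G := @open (unit_ball_type v))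
    (W := fun U n => cylinders n U)) => //.
  + by move=> U V; exact: openI.
  + exact: openT.
  + by move=> U n _; exact: cylinders_indep.
  + by move=> U n _; exact: cylinders_subS.
  + exact: bigcup_cylinders.
Qed.

End Discs.

Theorem theorem16 (R : realType) (p : nat) (Qp : fieldType)
    (absQp : absval R Qp) (K : fieldExtType Qp) (absK : absval R K)
    (m e f : nat) (L : {subfield K}) (gamma beta : K)
    (mu : {measure set (borel (vspace absK)) -> \bar R})
    (p_prime : prime p)
    (Qp_padic : is_padic_field p absQp)
    (degK : \dim {:K}%VS = m)
    (absK_ext : forall c : Qp, absK c%:A = absQp c)
    (ramK : ramification_index absQp absK {:K}%AS e)
    (resK : residue_degree absQp absK {:K}%AS f)
    (degL : \dim L = f)
    (unramL : unramified absQp absK L)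
    (gamma_prim : (p ^ f - 1)%N.-primitive_root gamma)
    (L_gamma : <<1; gamma>>%VS = L)
    (K_beta : <<L; beta>>%VS = {:K}%VS)
    (abs_beta : absK beta = p%:R `^ e%:R^-1)
    (mu_haar : haar_measure mu)
    (mu_ball : mu (unit_ball absK) = 1%E) :
  exact_system (unit_ball_measure mu : {measure set _ -> \bar R})
    (cf_map p absQp absK e f gamma beta).
Proof.
have KU : ultrametric absK := ext_ultrametric p_prime Qp_padic absK_ext.
pose fl := ext_floor p absQp e f gamma beta.
have fl_lt1 x : absK (x - fl x) < 1.
  exact: (ext_floor_lt1 p_prime Qp_padic absK_ext ramK resK gamma_prim abs_beta).
have fl_eq x y : absK (x - y) < 1 -> fl x = fl y.
  exact: (ext_floor_eq p_prime Qp_padic absK_ext ramK resK gamma_prim abs_beta).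
have /countable_injP[code code_inj] : countable (range fl).
  exact: (countable_ext_floor p_prime Qp_padic absK_ext ramK resK gamma_prim abs_beta).
pose decode i := xget 0 [set c | range fl c /\ code c = i].
have decode_fl x : decode (code (fl x)) = fl x.
  have [|fx] := @xgetPex _ 0 [set c | range fl c /\ code c = code (fl x)].
    by exists (fl x); split => //; exists x.
  by move=> /code_inj; apply; apply/mem_set => //; exists x.
(* Representatives of the residue field: the digit combinations of the powers of [gamma]. *)
pose rep (i : 'I_#|{ffun 'I_f -> 'I_p}|) : K :=
  \sum_j (enum_val i j)%:R *: gamma ^+ j.
have [_ mu_trans _ _ _] := mu_haar.
apply: (@unit_ball_map_exact R K absK beta _ rep mu KU _ _ _ _ _ mu_trans mu_ball
  fl code decode fl_lt1 decode_fl fl_eq).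
- exact: (absv_beta_gt1 p_prime ramK abs_beta).
- exact: (absv_beta_pow p_prime Qp_padic ramK abs_beta).
- move=> y y1.
  have [c yc] := gamma_digits_exist p_prime Qp_padic absK_ext gamma_prim resK y1.
  by exists (enum_rank c); rewrite /rep enum_rankK.
- move=> i j ij; apply: enum_val_inj.
  exact: (gamma_digits_inj p_prime Qp_padic absK_ext gamma_prim ij).
- move=> i; apply: (absv_sum_le KU) => // j _.
  rewrite (ext_absvZ absK_ext) (absv_gammaX absK gamma_prim) mulr1.
  exact: (padic_absv_natr_le1 p_prime Qp_padic).
- move=> x x0; rewrite /cf_map (negPf x0); apply: ball_valK; exact: fl_lt1.
Qed.
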